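(* Let $n\ge 1$, $1\le M\le n$, $\underline{s}=(s_1,\dots,s_n)\in\mathbb{R}^n$ and $y\in P_{A_n}$. The integral $\int_{Q_{A_n}}e^{-\mathrm{tr}(y\eta)}\delta^{(M)}_{\underline{s}}(\eta)\varphi_{A_n}(\eta)\,d\eta$ converges if and only if $s_i>\frac12$ for all $i\ne M$ and $s_M>0$. In this case, $$\int_{Q_{A_n}}e^{-\mathrm{tr}(y\eta)}\delta^{(M)}_{\underline{s}}(\eta)\varphi_{A_n}(\eta)\,d\eta=\pi^{(n-1)/2}\Bigl\{\prod_{i\ne M}\Gamma\bigl(s_i-\tfrac12\bigr)\Bigr\}\Gamma(s_M)\,\Delta^{(M)}_{-\underline{s}}(y).$$ (Here $\pi$ is the number $3.14\ldots$.)
   Context: $G=A_n$ is the path graph $1-2-\cdots-n$ on $V=\{1,\dots,n\}$; $E=\{(i,j): |i-j|\le 1\}$. $Z_G$ is the space of real symmetric $n\times n$ matrices $y$ with $y_{ij}=0$ if $(i,j)\notin E$; $P_{A_n}=P_G$ is the set of positive definite $y\in Z_G$. $I_G$ is the dual space of $Z_G$, realised as the space of incomplete symmetric matrices $\eta=(\eta_{ij})_{(i,j)\in E}$, with $\langle y,\eta\rangle=\mathrm{tr}(y\eta)=\sum_{(i,j)\in E}y_{ij}\eta_{ij}$. $Q_{A_n}=Q_G=\{\eta\in I_G:\langle y,\eta\rangle>0\ \forall y\in\overline{P_G}\setminus\{0\}\}$ (for $n\ge2$: all $2\times2$ blocks $\eta_{\{i,i+1\}}$ are positive definite). $d\eta=\prod_{(i,j)\in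 E,\,i\le j}d\eta_{ij}$ is Lebesgue measure. For $I\subset V$, $y_I$ (resp. $\eta_I$) is the submatrix with rows and columns in $I$; $\{i:j\}=\{i,\dots,j\}$; $|\cdot|$ is the determinant. With the convention $s_0=s_{n+1}=0$, $$\Delta^{(M)}_{\underline{s}}(y)=\prod_{i=1}^{M-1}|y_{\{1:i\}}|^{s_i-s_{i+1}}\;|y|^{s_M}\prod_{i=M+1}^{n}|y_{\{i:n\}}|^{s_i-s_{i-1}},$$ $$\delta^{(M)}_{\underline{s}}(\eta)=\frac{\prod_{i=1}^{M-1}|\eta_{\{i:i+1\}}|^{s_i}\prod_{i=M+1}^{n}|\eta_{\{i-1:i\}}|^{s_i}}{\prod_{i=2}^{M-1}\eta_{ii}^{s_{i-1}}\cdot\eta_{MM}^{s_{M-1}-s_M+s_{M+1}}\cdot\prod_{i=M+1}^{n-1}\eta_{ii}^{s_{i+1}}}.$$ $\varphi_{A_1}(\eta)=\eta^{-1}$, and for $n\ge2$, $\varphi_{A_n}(\eta)=\prod_{i=1}^{n-1}|\eta_{\{i,i+1\}}|^{-3/2}\prod_{i=2}^{n-1}\eta_{ii}$. *)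

(* Defs.v *)
From HB Require Import structures.
From mathcomp Require Import all_boot all_order all_algebra.
From mathcomp Require Import all_classical all_reals all_analysis.

Set Implicit Arguments.
Unset Strict Implicit.
Unset Printing Implicit Defensive.

Import Order.TTheory GRing.Theory Num.Theory.
Import numFieldNormedType.Exports.

Local Open Scope classical_set_scope.
Local Open Scope ring_scope.

Definition Gamma (R : realType) (x : R) : R :=
  \int[lebesgue_measure]_(t in `]0, +oo[) (t `^ (x - 1) * expR (- t)).

Section lebesgue_tuple.
Context (R : realType).
Local Notation mR := (measurableTypeR R).

(* lebesgue_tuple n below is n-dimensional Lebesgue measure: the Dirac mass for
   n = 0, then the image of lebesgue_measure \x lebesgue_tuple n under cons. *)

Definition tuple_cons (n : nat) (u : mR * n.-tuple mR) : n.+1.-tuple mR :=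
  [tuple of u.1 :: u.2].

Definition tuple_uncons (n : nat) (t : n.+1.-tuple mR) : mR * n.-tuple mR :=
  (thead t, [tuple of behead t]).

Lemma tuple_consK n : cancel (@tuple_cons n) (@tuple_uncons n).
Proof. by move=> [x t]; congr (_, _); apply: val_inj. Qed.

Lemma measurable_tuple_cons n : measurable_fun setT (@tuple_cons n).
Proof. exact: measurable_cons. Qed.

HB.instance Definition _ n :=
  isMeasurableFun.Build _ _ _ _ (@tuple_cons n) (@measurable_tuple_cons n).

Lemma measurable_tuple_uncons n : measurable_fun setT (@tuple_uncons n).
Proof.
apply/measurable_fun_pairP; split.
  exact: measurable_tnth.
exact: measurable_behead.
Qed.

Definition lebesgue_tuple_step (n : nat)
    (mu : {sigma_finite_measure set (n.-tuple mR) -> \bar R}) :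
    set (n.+1.-tuple mR) -> \bar R :=
  pushforward (lebesgue_measure \x mu)%E (@tuple_cons n).

HB.instance Definition _ n mu := Measure.copy (@lebesgue_tuple_step n mu)
  (measure_function_pushforward__canonical__measure_function_Measure
     (lebesgue_measure \x mu)%E (@measurable_tuple_cons n)).

Lemma sigma_finite_lebesgue_tuple_step n mu :
  sigma_finite setT (@lebesgue_tuple_step n mu).
Proof.
have [F FT mF] : sigma_finite setT (lebesgue_measure \x mu)%E.
  have /sigma_finiteP[F [TF ndF Foo]] := sigma_finiteT (@lebesgue_measure R).
  have /sigma_finiteP[G [TG ndG Goo]] := sigma_finiteT mu.
  exists (fun k => F k `*` G k).
    rewrite -setXTT TF TG predeqE => -[x t]; split=> [|[k _ [Fkx Gkt]]].
      move=> [/= [k _ Fkx] [l _ Glt]]; exists (maxn k l) => //; split.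
        by move: x Fkx; exact/subsetPset/ndF/leq_maxl.
      by move: t Glt; exact/subsetPset/ndG/leq_maxr.
    by split; exists k.
  move=> k; have [mFk Fkoo] := Foo k; have [mGk Gkoo] := Goo k.
  split; first exact: measurableX.
  by rewrite product_measure1E// lte_mul_pinfty// ge0_fin_numE.
exists (fun i => @tuple_uncons n @^-1` F i).
  by rewrite -preimage_bigcup -FT preimage_setT.
move=> i; have [mFi Fioo] := mF i; split.
  by rewrite -[X in measurable X]setTI; exact: measurable_tuple_uncons.
rewrite /lebesgue_tuple_step /pushforward -comp_preimage.
by rewrite (_ : _ \o _ = id)//; apply/funext => u /=; rewrite tuple_consK.
Qed.

HB.instance Definition _ n mu := Measure_isSigmaFinite.Build _ _ _
  (@lebesgue_tuple_step n mu) (@sigma_finite_lebesgue_tuple_step n mu).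

Fixpoint lebesgue_tuple (n : nat) :
    {sigma_finite_measure set (n.-tuple mR) -> \bar R} :=
  if n is m.+1 then lebesgue_tuple_step (lebesgue_tuple m)
  else (\d_([tuple] : 0.-tuple mR)).

End lebesgue_tuple.

(* Coordinates of an incomplete symmetric matrix eta on the path 1 - ... - n:
   the first tuple holds eta_11, ..., eta_nn and the second one
   eta_12, eta_23, ..., eta_(n-1)n. *)
Notation incomplete R n :=
  (n.-tuple (measurableTypeR R) * n.-1.-tuple (measurableTypeR R))%type.

Section path_graph.
Context (R : realType) (n : nat).

Definition path_edge : rel 'I_n := fun i j => (i <= j.+1)%N && (j <= i.+1)%N.

(* Zspace, Pcone and Qcone are Z_G, P_G and Q_G for the path graph G = A_n. *)
Definition Zspace : set 'M[R]_n :=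
  [set y | y^T = y /\ forall i j, ~~ path_edge i j -> y i j = 0].

Definition Pcone : set 'M[R]_n :=
  [set y | Zspace y /\
     forall v : 'cV[R]_n, v != 0 -> 0 < (v^T *m y *m v) ord0 ord0].

(* The entries off the edge set are padded with 0. Everything below only looks
   at entries on the edge set, so the padding is irrelevant. *)
Definition incomplete_mx (eta : incomplete R n) : 'M[R]_n :=
  \matrix_(i, j) if i == j then tnth eta.1 i
                 else if path_edge i j then nth 0 eta.2 (minn i j) else 0.

(* tr (y eta): off-diagonal products count twice, as both (i, j) and (j, i) are
   in the edge set. *)
Definition pairing (y : 'M[R]_n) (eta : incomplete R n) : R :=
  \sum_(i < n) \sum_(j < n | path_edge i j) y i j * incomplete_mx eta i j.

Definition Qcone : set (incomplete R n) :=
  [set eta | forall y, closure Pcone y -> y != 0 -> 0 < pairing y eta].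

Definition lebesgue_incomplete : {measure set (incomplete R n) -> \bar R} :=
  (lebesgue_tuple R n \x lebesgue_tuple R n.-1)%E.

(* From here on indices are 1-based natural numbers: the vertex k is the
   element k - 1 of 'I_n. *)

(* The k-th entry s_k, with s_0 = s_(n+1) = 0. *)
Definition entry (s : 'rV[R]_n) (k : nat) : R :=
  if k is k'.+1 then oapp (s ord0) 0 (insub k') else 0.

Definition diag_entry (eta : incomplete R n) (k : nat) : R := nth 0 eta.1 k.-1.

(* The principal submatrix A_I. *)
Definition principal_submx (A : 'M[R]_n) (I : {set 'I_n}) : 'M[R]_#|I| :=
  mxsub (fun a => enum_val a) (fun a => enum_val a) A.

(* The determinant of A_{i:j}, where {i:j} = {i, ..., j}. *)
Definition minor (A : 'M[R]_n) (i j : nat) : R :=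
  \det (principal_submx A [set k : 'I_n | (i <= k.+1 <= j)%N]%SET).

Definition Delta (M : nat) (s : 'rV[R]_n) (y : 'M[R]_n) : R :=
  (\prod_(1 <= i < M) minor y 1 i `^ (entry s i - entry s i.+1))
  * \det y `^ entry s M
  * \prod_(M.+1 <= i < n.+1) minor y i n `^ (entry s i - entry s i.-1).

Definition delta (M : nat) (s : 'rV[R]_n) (eta : incomplete R n) : R :=
  let e := incomplete_mx eta in
  ((\prod_(1 <= i < M) minor e i i.+1 `^ entry s i)
   * \prod_(M.+1 <= i < n.+1) minor e i.-1 i `^ entry s i)
  / ((\prod_(2 <= i < M) diag_entry eta i `^ entry s i.-1)
     * diag_entry eta M `^ (entry s M.-1 - entry s M + entry s M.+1)
     * \prod_(M.+1 <= i < n) diag_entry eta i `^ entry s i.+1).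

Definition phi (eta : incomplete R n) : R :=
  if n == 1%N then (diag_entry eta 1)^-1
  else (\prod_(1 <= i < n) minor (incomplete_mx eta) i i.+1 `^ (- (3 / 2)))
       * \prod_(2 <= i < n) diag_entry eta i.

End path_graph.

Arguments lebesgue_incomplete : clear implicits.
Arguments Pcone : clear implicits.
Arguments Qcone : clear implicits.

(* Main.v *)
From HB Require Import structures.
Require Import Defs.
From mathcomp Require Import all_boot all_order all_algebra.
From mathcomp Require Import all_classical all_reals all_analysis.
From mathcomp Require Import measurable_realfun zify ring lra.
Import Order.TTheory GRing.Theory Num.Theory.
Import numFieldNormedType.Exports.
Set Implicit Arguments.
Unset Strict Implicit.
Unset Printing Implicit Defensive.
Local Open Scope classical_set_scope.
Local Open Scope ring_scope.

(** Why the formula holds.  Write N.+1 for the number of vertices, numbered from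
    0, and r for the root (the vertex M).  Orient the path towards r.  On Q the
    integrand is a product of one factor per vertex, exp (- al_i a) a^p_i, and
    one factor per edge, exp (- 2 be_i b) (a c - b^2)^q_i, where al_i and be_i
    are the diagonal and off-diagonal entries of y ([delta_phiE], [chain_eta]).
    Collecting exponents, an edge carries s_c - 3/2 with c its end farther from
    the root, and a vertex carries the sum of 1 - s_c over its children c, plus
    s_r - 1 at the root.  In particular a leaf other than the root has
    exponent 0.

    A leaf with parent variable c can then be integrated out in closed form
    ([integral_vertex_edge]): the substitution a = b^2 / c + x makes the
    determinant equal to x c, so x contributes a Gamma integral and b a Gaussian
    one, and the result is
      sqrt pi * Gamma (s - 1/2) * al^(- s) * c^(s - 1) * exp (be^2 / al * c).
    The power of c cancels the summand 1 - s that the leaf contributed to the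
    exponent of its parent, and the exponential replaces the parent coefficient
    by its Schur complement.  So the parent becomes a leaf of the same kind and
    the elimination goes on until only the root is left, where a last Gamma
    integral gives Gamma (s_r) ([integral_chain_integral]).  The powers of the
    successive pivots multiply up to Delta because leading and trailing
    principal minors are products of pivots ([minor_power_root0],
    [minor_powerS]).

    Everything is nonnegative, hence Tonelli's theorem applies throughout and
    the identity holds in the extended reals for every s, with Gamma replaced by
    the integral [eGamma] that takes the value +oo at x <= 0 ([eGamma_ltyE]).
    As all the factors are positive, the product is finite if and only if each
    factor is, which is the convergence criterion.

    Two points of linear algebra support this.  First, Q is the set of eta whose
    2 x 2 blocks are positive definite ([QconeP]): a Schur complement induction
    shows that the pairing with a positive semidefinite y is positive, and rank
    one matrices supported on an edge give the converse.  Second, the minors of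
    y are continuants, whose two-term recursion ([continuantSS]) gives the
    pivots from both ends of the path. *)

(** * Affine substitutions, truncated powers and the Gaussian integral *)

Section affine.
Context {R : realType}.
Local Notation mR := (measurableTypeR R).
Local Notation mu := (@lebesgue_measure R).
Variables (k c : R).
Definition affine_map (x : mR) : mR := k * x + c.

Lemma measurable_affine_map : measurable_fun setT affine_map.
Proof. by apply: measurable_funD => //; apply: measurable_funM. Qed.

Lemma affine_map_preimage (a b : R) : 0 < k ->
  affine_map @^-1` `]a, b] = `](a - c) / k, (b - c) / k]%classic.
Proof.
move=> k0; apply/seteqP; split=> x /=; rewrite /affine_map !in_itv/=;
  by rewrite ltr_pdivrMr// ler_pdivlMr// ltrBlDr lerBrDr [x * k]mulrC.
Qed.

HB.instance Definition _ := isMeasurableFun.Build _ _ _ _ affine_map measurable_affine_map.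

(** Up to the factor k, the image of Lebesgue measure under an increasing affine
    map agrees with Lebesgue measure on half-open intervals, hence everywhere. *)
Lemma ge0_integral_affine (f : R -> \bar R) : 0 < k ->
  measurable_fun setT f -> (forall x, 0 <= f x)%E ->
  (\int[mu]_x f x = k%:E * \int[mu]_x f (k * x + c)%R)%E.
Proof.
move=> k0 mf f0.
pose kk := NngNum (ltW k0).
pose nu := pushforward mu affine_map.
rewrite -(@ge0_integral_pushforward _ _ _ _ _ _ measurable_affine_map mu setT f measurableT mf)//.
rewrite -(@ge0_integral_mscale _ _ _ nu setT measurableT kk f)//.
apply: eq_measure_integral => A mA _.
apply: (lebesgue_measure_unique (mu := mscale kk nu)) => // X.
move=> [[a b] /= ab <-].
rewrite /mscale/= /nu /pushforward affine_map_preimage// !lebesgue_measure_itv/=.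
rewrite !lte_fin ltr_pM2r ?invr_gt0// ltrD2r.
case: ifP => _; last by rewrite mule0.
by rewrite -!EFinD -EFinM; congr EFin; field; rewrite gt_eqF.
Qed.
End affine.

Section ppowR.
Context {R : realType}.
Implicit Types x y p q : R.

(** Cutting the power off at 0 builds the condition that eta lies in Q into the
    integrand: all integrals below can then run over whole spaces. *)
Definition ppowR x p : R := if 0 < x then x `^ p else 0.

Lemma ppowR_ge0 x p : 0 <= ppowR x p.
Proof. by rewrite /ppowR; case: ifP => // _; exact: powR_ge0. Qed.

Lemma gt0_ppowR x p : 0 < x -> ppowR x p = x `^ p.
Proof. by rewrite /ppowR => ->. Qed.

Lemma le0_ppowR x p : x <= 0 -> ppowR x p = 0.
Proof. by rewrite /ppowR ltNge => ->. Qed.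

Lemma ppowRMl x y p : 0 < x -> ppowR (x * y) p = x `^ p * ppowR y p.
Proof.
move=> x0; rewrite /ppowR pmulr_rgt0//; case: ifP => [y0|]; last by rewrite mulr0.
by rewrite powRM// ltW.
Qed.

Lemma gt0_powRD x p q : 0 < x -> x `^ (p + q) = x `^ p * x `^ q.
Proof. by move=> x0; rewrite powRD//; apply/implyP => _; rewrite gt_eqF. Qed.

Lemma measurable_ppowR p : measurable_fun setT (fun x : R => ppowR x p).
Proof.
by apply: measurable_fun_ifT => //; exact: measurable_fun_ltr.
Qed.

Lemma measurable_ppowR_comp d (T : measurableType d) (f : T -> R) p :
  measurable_fun setT f -> measurable_fun setT (fun z => ppowR (f z) p).
Proof. by move=> mf; apply: measurableT_comp (measurable_ppowR p) mf. Qed.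
End ppowR.

Section gauss.
Context {R : realType}.
Local Notation mu := (@lebesgue_measure R).
(** Completing the square gives a multiple of the normal density of mean
    - m / k and variance 1 / (2 k). *)
Lemma integral_expR_quadratic (k m : R) : 0 < k ->
  (\int[mu]_b (expR (- (k * b ^+ 2 + 2 * m * b)))%:E
    = (Num.sqrt (pi / k) * expR (m ^+ 2 / k))%:E)%E.
Proof.
move=> k0; pose sigma := Num.sqrt (2 * k)^-1.
have s2 : sigma ^+ 2 = (2 * k)^-1.
  by rewrite sqr_sqrtr// invr_ge0 mulr_ge0// ltW.
have s0 : sigma != 0 by rewrite gt_eqF// sqrtr_gt0 invr_gt0 mulr_gt0.
have := integral_normal_pdf (- m / k) sigma.
rewrite /normal_pdf (negbTE s0) /normal_peak /normal_fun s2.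
set C := Num.sqrt _.
have C0 : 0 < Num.sqrt (pi / k) by rewrite sqrtr_gt0 divr_gt0// pi_gt0.
have -> : C = Num.sqrt (pi / k).
  by rewrite /C; congr Num.sqrt; field; rewrite gt_eqF.
move=> I1.
transitivity ((Num.sqrt (pi / k) * expR (m ^+ 2 / k))%:E * 1)%E; last by rewrite mule1.
rewrite -I1 -ge0_integralZl//=.
- apply: eq_integral => x _; rewrite -EFinM; congr EFin.
  rewrite mulrACA divff ?gt_eqF// mul1r -expRD; congr expR.
  by field; rewrite gt_eqF.
- apply/measurable_EFinP; apply: measurable_funM => //.
  apply: measurableT_comp => //; apply: measurable_funM => //.
  apply: measurableT_comp => //; apply: measurable_funX.
  exact: measurable_funB.
Qed.
End gauss.

(** * Integrating out a leaf *)

(** [ge0_integralZl] for real-valued integrands. *)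
Lemma ge0_integral_EFinZl d (T : measurableType d) (R : realType)
    (m : {measure set T -> \bar R}) (k : R) (f : T -> R) :
  measurable_fun setT f -> (forall x, 0 <= f x) -> 0 <= k ->
  (\int[m]_x (k * f x)%:E = k%:E * \int[m]_x (f x)%:E)%E.
Proof.
move=> mf f0 k0; under eq_integral do rewrite EFinM.
rewrite ge0_integralZl//; first exact/measurable_EFinP.
by move=> x _; rewrite lee_fin.
Qed.

Section edge.
Context {R : realType}.
Local Notation mu := (@lebesgue_measure R).

(** Euler's integral without convergence hypothesis: +oo for x <= 0. *)
Definition eGamma (x : R) : \bar R :=
  (\int[mu]_t (ppowR t (x - 1) * expR (- t))%:E)%E.

Lemma eGamma_ge0 x : (0 <= eGamma x)%E.
Proof.
by apply: integral_ge0 => t _; rewrite lee_fin mulr_ge0 ?ppowR_ge0 ?expR_ge0.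
Qed.

(** The factors of the integrand attached to a vertex with variable a, and to an
    edge with variable b between vertices with variables a and c. *)
Definition vertex (al p a : R) : R := expR (- (al * a)) * ppowR a p.
Definition edge (be q a b c : R) : R :=
  expR (- (2 * be * b)) * ppowR (a * c - b ^+ 2) q.

Lemma vertex_ge0 al p a : 0 <= vertex al p a.
Proof. by rewrite mulr_ge0 ?expR_ge0 ?ppowR_ge0. Qed.

Lemma edge_ge0 be q a b c : 0 <= edge be q a b c.
Proof. by rewrite mulr_ge0 ?expR_ge0 ?ppowR_ge0. Qed.

Lemma vertex_le0 al p a : a <= 0 -> vertex al p a = 0.
Proof. by move=> a0; rewrite /vertex le0_ppowR// mulr0. Qed.

Lemma measurable_vertex d (T : measurableType d) al p (f : T -> R) :
  measurable_fun setT f -> measurable_fun setT (fun z => vertex al p (f z)).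
Proof.
move=> mf; apply: measurable_funM; last exact: measurable_ppowR_comp.
by apply: measurableT_comp => //; apply: measurableT_comp => //; apply: measurable_funM.
Qed.

Lemma measurable_edge d (T : measurableType d) be q (f g h : T -> R) :
  measurable_fun setT f -> measurable_fun setT g -> measurable_fun setT h ->
  measurable_fun setT (fun z => edge be q (f z) (g z) (h z)).
Proof.
move=> mf mg mh; apply: measurable_funM.
  by apply: measurableT_comp => //; apply: measurableT_comp => //; apply: measurable_funM.
apply: measurable_ppowR_comp; apply: measurable_funB; last exact: measurable_funX.
exact: measurable_funM.
Qed.

Definition edge_integral (be q a c : R) : \bar R := (\int[mu]_b (edge be q a b c)%:E)%E.

Lemma edge_integralC be q a c : edge_integral be q a c = edge_integral be q c a.
Proof. by apply: eq_integral => b _; rewrite /edge mulrC [a * c]mulrC mulrC. Qed.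

Lemma edge_integral_ge0 be q a c : (0 <= edge_integral be q a c)%E.
Proof. by apply: integral_ge0 => b _; rewrite lee_fin edge_ge0. Qed.

Lemma measurable_edge_integral be q c :
  measurable_fun setT (fun a => edge_integral be q a c).
Proof.
pose f (z : measurableTypeR R * measurableTypeR R) := (edge be q z.1 z.2 c)%:E.
have := @measurable_fun_fubini_tonelli_F _ _ _ _ R mu f.
apply; last by move=> z; rewrite lee_fin edge_ge0.
by apply/measurable_EFinP; apply: measurable_edge.
Qed.

(** Substituting a = t / al + b^2 / c turns a c - b^2 into c t / al. *)
Lemma integral_shifted_gamma (al c b q : R) : 0 < al -> 0 < c ->
  (\int[mu]_a (expR (- (al * a)) * ppowR (a * c - b ^+ 2) q)%:E =
   (al `^ (- (q + 1)) * c `^ q * expR (- (al / c * b ^+ 2)))%:E * eGamma (q + 1))%E.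
Proof.
move=> al0 c0; have ali0 : 0 < al^-1 by rewrite invr_gt0.
rewrite (@ge0_integral_affine R al^-1 (b ^+ 2 / c))//; first last.
- by move=> x; rewrite lee_fin mulr_ge0 ?expR_ge0 ?ppowR_ge0.
- apply/measurable_EFinP; apply: measurable_funM.
    by apply: measurableT_comp => //; apply: measurableT_comp => //; apply: measurable_funM.
  by apply: measurable_ppowR_comp; apply: measurable_funB => //; apply: measurable_funM.
transitivity (al^-1%:E * ((((al^-1 * c) `^ q) * expR (- (al / c * b ^+ 2)))%:E * eGamma (q + 1)))%E; last first.
  rewrite muleA -EFinM; congr (_%:E * _)%E.
  rewrite powRM ?(ltW ali0) ?(ltW c0)// !mulrA -[al^-1]powR_inv1 ?ltW//.
  by rewrite -powRrM -gt0_powRD//; congr (_ `^ _ * _ * _); ring.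
congr (_ * _)%E.
rewrite /eGamma -ge0_integralZl//; first last.
- by rewrite lee_fin mulr_ge0 ?powR_ge0 ?expR_ge0.
- by move=> x _; rewrite lee_fin mulr_ge0 ?expR_ge0 ?ppowR_ge0.
- apply/measurable_EFinP; apply: measurable_funM; first exact: measurable_ppowR_comp.
  by apply: measurableT_comp => //; apply: measurableT_comp.
apply: eq_integral => t _; rewrite -EFinM; congr EFin.
rewrite (_ : _ - _ = (al^-1 * c) * t); last by field; rewrite !gt_eqF.
rewrite ppowRMl ?mulr_gt0// (_ : q + 1 - 1 = q); last by ring.
rewrite (_ : expR _ = expR (- (al / c * b ^+ 2)) * expR (- t)); first by ring.
by rewrite -expRD; congr expR; field; rewrite !gt_eqF.
Qed.

(** Elimination of a leaf: integrating over a first leaves a Gaussian in b, whose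
    value grows like exp (be^2 / al * c); this is what turns the coefficient of c
    into a Schur complement. *)
Lemma integral_vertex_edge (al be sg c : R) : 0 < al -> 0 < c ->
  (\int[mu]_a ((vertex al 0 a)%:E * edge_integral be (sg - 3 / 2) a c)
   = (Num.sqrt pi)%:E * eGamma (sg - 1 / 2) *
     (al `^ (- sg) * c `^ (sg - 1) * expR (be ^+ 2 / al * c))%:E)%E.
Proof.
move=> al0 c0; set q := sg - 3 / 2.
have -> : sg - 1 / 2 = q + 1 by rewrite /q; field.
pose f (z : measurableTypeR R * measurableTypeR R) :=
  (expR (- (al * z.1)) * edge be q z.1 z.2 c)%:E.
have f0 z : (0 <= f z)%E by rewrite lee_fin mulr_ge0 ?edge_ge0 ?expR_ge0.
have mf : measurable_fun setT f.
  apply/measurable_EFinP; apply: measurable_funM; last exact: measurable_edge.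
  by apply: measurableT_comp => //; apply: measurableT_comp => //; apply: measurable_funM.
transitivity (\int[mu]_a \int[mu]_b f (a, b))%E.
  apply: eq_integral => a _; rewrite -ge0_integral_EFinZl ?vertex_ge0//.
  - apply: eq_integral => b _; congr EFin.
    rewrite /= /vertex /edge; set X := expR _; set Y := expR _.
    have [a0|a0] := ltP 0 a.
      by rewrite [ppowR a 0]gt0_ppowR// powRr0; ring.
    (* For a <= 0 the edge factor vanishes as well, because c > 0. *)
    rewrite !le0_ppowR//; first by ring.
    by rewrite subr_le0 (le_trans (y := 0)) ?sqr_ge0// mulr_le0_ge0// ltW.
  - exact: measurable_edge.
  - by move=> b; rewrite edge_ge0.
(* The order is exchanged so that the inner integral is over a. *)
rewrite (@fubini_tonelli _ _ _ _ R mu mu f mf f0).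
transitivity (\int[mu]_b ((al `^ (- (q + 1)) * c `^ q)%:E * eGamma (q + 1) *
    (expR (- (al / c * b ^+ 2 + 2 * be * b)))%:E))%E.
  apply: eq_integral => b _ /=.
  transitivity ((expR (- (2 * be * b)))%:E *
    \int[mu]_a (expR (- (al * a)) * ppowR (a * c - b ^+ 2) q)%:E)%E.
    rewrite -ge0_integral_EFinZl ?expR_ge0.
    - by apply: eq_integral => a _; congr EFin; rewrite /f/= /edge; ring.
    - apply: measurable_funM.
        by apply: measurableT_comp => //; apply: measurableT_comp => //; apply: measurable_funM.
      by apply: measurable_ppowR_comp; apply: measurable_funB => //; apply: measurable_funM.
    - by move=> x; rewrite mulr_ge0 ?expR_ge0 ?ppowR_ge0.
    - by [].
  rewrite integral_shifted_gamma// muleA -EFinM muleAC -EFinM; congr (_%:E * _)%E.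
  rewrite [in RHS](opprD (al / c * b ^+ 2)) expRD; ring.
rewrite ge0_integralZl//; first last.
- by rewrite mule_ge0 ?eGamma_ge0// lee_fin mulr_ge0 ?powR_ge0.
- apply/measurable_EFinP; apply: measurableT_comp => //; apply: measurableT_comp => //.
  by apply: measurable_funD; apply: measurable_funM => //; exact: measurable_funX.
rewrite integral_expR_quadratic ?divr_gt0//.
rewrite muleAC -EFinM -[RHS]muleA [X in _ = (_ * X)%E]muleC muleA -EFinM; congr (_%:E * _)%E.
rewrite (_ : pi / (al / c) = pi * c * al^-1); last by field; rewrite !gt_eqF.
rewrite !sqrtrM ?mulr_ge0 ?pi_ge0 ?ltW// -!powR12_sqrt ?pi_ge0 ?invr_ge0 ?ltW//.
rewrite (_ : be ^+ 2 / (al / c) = be ^+ 2 / al * c); last by field; rewrite !gt_eqF.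
set E := expR _; rewrite -[al^-1]powR_inv1 ?ltW// -powRrM.
rewrite (_ : - sg = - (q + 1) + -1 * 2^-1); last by rewrite /q; field.
rewrite (_ : sg - 1 = q + 2^-1); last by rewrite /q; field.
clearbody q; rewrite (gt0_powRD _ _ al0) (gt0_powRD q _ c0); ring.
Qed.
End edge.

(** * The Gamma integral in the extended reals *)

Section eGamma_theory.
Context {R : realType}.
Local Notation mu := (@lebesgue_measure R).

Lemma integral_vertex (al x : R) : 0 < al ->
  (\int[mu]_a (vertex al (x - 1) a)%:E = eGamma x * (al `^ (- x))%:E)%E.
Proof.
move=> al0; have ali0 : 0 < al^-1 by rewrite invr_gt0.
rewrite (@ge0_integral_affine R al^-1 0)//; first last.
- by move=> a; rewrite lee_fin vertex_ge0.
- by apply/measurable_EFinP; exact: measurable_vertex.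
rewrite [RHS]muleC /eGamma.
transitivity (al^-1%:E * ((al^-1 `^ (x - 1))%:E * eGamma x))%E; last first.
  rewrite muleA -EFinM; congr (_%:E * _)%E.
  rewrite -[al^-1]powR_inv1 ?ltW//.
  by rewrite -powRrM -gt0_powRD//; congr (_ `^ _); ring.
congr (_ * _)%E; rewrite /eGamma -ge0_integral_EFinZl ?powR_ge0.
- apply: eq_integral => t _; congr EFin; rewrite addr0 /vertex ppowRMl//.
  by rewrite mulVKf ?gt_eqF//; ring.
- apply: measurable_funM; first exact: measurable_ppowR_comp.
  by apply: measurableT_comp => //; apply: measurableT_comp.
- by move=> t; rewrite mulr_ge0 ?expR_ge0 ?ppowR_ge0.
- by [].
Qed.

(** The interval ]1, 2] is only a convenient place of positive measure on which
    powers are easily bounded below. *)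
Lemma integral_gt0_itv12 (f : R -> R) (m : R) : measurable_fun setT f ->
  (forall t, 0 <= f t) -> 0 < m -> (forall t, 1 < t -> t <= 2 -> m <= f t) ->
  (0 < \int[mu]_t (f t)%:E)%E.
Proof.
move=> mf f0 m0 fm; have mef : measurable_fun setT (EFin \o f) by exact/measurable_EFinP.
have m12 : (\int[mu]_(t in `]1%R, 2%R]) (cst m%:E t) = m%:E)%E.
  rewrite integral_cst//= lebesgue_measure_itv/= lte_fin ltr1n -EFinD -EFinM.
  by congr EFin; ring.
have mle : (m%:E <= \int[mu]_(t in `]1%R, 2%R]) (f t)%:E)%E.
  rewrite -m12; apply: ge0_le_integral => //.
  - by move=> t _; rewrite lee_fin ltW.
  - exact: measurable_funTS.
  - by move=> t /=; rewrite in_itv/= lee_fin => /andP[? ?]; exact: fm.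
have := @ge0_subset_integral _ _ _ mu `]1%R, 2%R]%classic setT _ _ (EFin \o f) mef.
move=> /(_ _ measurableT) sub.
apply: lt_le_trans (le_trans mle _); first by rewrite lte_fin.
by apply: sub => // t _; rewrite lee_fin.
Qed.

Lemma powR_ge_itv12 (x t : R) : 1 < t -> t <= 2 -> expR (- `|x| * 2) <= t `^ x.
Proof.
move=> t1 t2; have t0 : 0 < t by rewrite (lt_trans _ t1).
rewrite /powR gt_eqF// ler_expR.
have l2 : `|ln t| <= 2.
  rewrite ger0_norm ?ln_ge0 ?ltW//.
  by rewrite (lt_le_trans (ln_sublinear t0)).
rewrite mulNr lerNl -mulrN (le_trans (ler_norm _))// normrM normrN.
by rewrite ler_wpM2l.
Qed.

Lemma eGamma_gt0 x : (0 < @eGamma R x)%E.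
Proof.
apply: (@integral_gt0_itv12 _ (expR (- `|x - 1| * 2) * expR (- 2))).
- apply: measurable_funM; first exact: measurable_ppowR_comp.
  by apply: measurableT_comp => //; apply: measurableT_comp.
- by move=> t; rewrite mulr_ge0 ?ppowR_ge0 ?expR_ge0.
- by rewrite mulr_gt0 ?expR_gt0.
- move=> t t1 t2; rewrite gt0_ppowR ?(lt_trans _ t1)//.
  apply: ler_pM; rewrite ?expR_ge0//; first exact: powR_ge_itv12.
  by rewrite ler_expR lerN2.
Qed.

(** Rescaling by 2 shows that the integral of t^(x - 1) exp (- t / 2) is
    2^x * eGamma x, hence at most eGamma x when x <= 0.  It also exceeds
    eGamma x by the integral of a positive function, so that eGamma x cannot be
    finite. *)
Lemma eGamma_infty x : x <= 0 -> (@eGamma R x = +oo)%E.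
Proof.
move=> x0; pose D (t : R) := vertex 2^-1 (x - 1) t - vertex 1 (x - 1) t.
have DE t : D t = ppowR t (x - 1) * (expR (- (2^-1 * t)) - expR (- t)).
  by rewrite /D /vertex mul1r; ring.
have D0 t : 0 <= D t.
  rewrite DE; have [t0|t0] := ltP 0 t; last by rewrite le0_ppowR// mul0r.
  by rewrite mulr_ge0 ?ppowR_ge0// subr_ge0 ler_expR lerN2; lra.
have mv al := @measurable_vertex R _ _ al (x - 1) id (@measurable_id _ _ setT).
have mD : measurable_fun setT D by exact: measurable_funB.
have Dgt0 : (0 < \int[mu]_t (D t)%:E)%E.
  apply: (@integral_gt0_itv12 _ (expR (- `|x - 1| * 2) * (expR (- 2) * 2^-1))) => //.
  move=> t t1 t2; rewrite DE gt0_ppowR ?(lt_trans _ t1)//.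
  apply: ler_pM; rewrite ?mulr_ge0 ?expR_ge0//; first exact: powR_ge_itv12.
  rewrite (_ : - (2^-1 * t) = - t + t / 2); last by field.
  rewrite expRD -[X in _ - X]mulr1 -mulrBr.
  apply: ler_pM; rewrite ?expR_ge0//; first by rewrite ler_expR lerN2.
  by have := expR_ge1Dx (t / 2); lra.
have I1 : (\int[mu]_t (vertex 1 (x - 1) t)%:E = eGamma x)%E.
  by rewrite integral_vertex// powR1 mule1.
have I2 : (\int[mu]_t (vertex 2^-1 (x - 1) t)%:E = eGamma x + \int[mu]_t (D t)%:E)%E.
  rewrite -I1 -ge0_integralD//.
  - by apply: eq_integral => t _; rewrite -EFinD; congr EFin; rewrite /D; ring.
  - by move=> t _; rewrite lee_fin vertex_ge0.
  - by apply/measurable_EFinP; exact: mv.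
  - by move=> t _; rewrite lee_fin.
  - by apply/measurable_EFinP.
move: I2; rewrite integral_vertex//.
have c1 : 2^-1 `^ (- x) <= 1 :> R.
  have h2 : (0 < 2^-1 :> R) by [].
  rewrite /powR gt_eqF// -[leRHS]expR0 ler_expR mulNr oppr_le0 mulr_le0//.
  by rewrite ln_le0// invf_le1// ler1n.
move=> I2; have [fin|] := ltP (eGamma x) +oo%E; last by rewrite leye_eq => /eqP.
have ge : (eGamma x * (2^-1 `^ (- x))%:E <= eGamma x)%E.
  by rewrite -[leRHS]mule1 lee_wpmul2l ?eGamma_ge0// lee_fin.
move: ge; rewrite I2 leNgt; case/negP; rewrite lteDl//.
by rewrite ge0_fin_numE ?eGamma_ge0.
Qed.
End eGamma_theory.

Section eGamma_finite.
Context {R : realType}.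
Local Notation mu := (@lebesgue_measure R).

(** The primitive t^x / x is nonnegative, so the bound does not depend on e. *)
Lemma integral_powR_le (x e : R) : 0 < x -> 0 < e -> e < 1 ->
  (\int[mu]_(t in `[e, 1%R]) (t `^ (x - 1))%:E <= (x^-1)%:E)%E.
Proof.
move=> x0 e0 e1; pose F (t : R) : R^o := x^-1 * t `^ x.
have dF (t : R) : 0 < t -> is_derive t 1 F (t `^ (x - 1)).
  move=> t0; have h := is_derive1_powR x t0.
  apply: is_derive_eq; rewrite /GRing.scale/= mulrA mulVf ?gt_eqF// mul1r//.
have cF (t : R) : 0 < t -> F @ t --> F t.
  by move=> t0; apply/differentiable_continuous/derivable1_diffP; case: (dF _ t0).
rewrite (@continuous_FTC2 R _ F)//.
- rewrite -EFinD lee_fin /F powR1 mulr1 gerBl mulr_ge0 ?powR_ge0// invr_ge0 ltW//.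
- apply: continuous_in_subspaceT => t; rewrite inE/= in_itv/= => /andP[et _].
  have t0 : 0 < t by exact: lt_le_trans et.
  apply/differentiable_continuous/derivable1_diffP.
  by case: (is_derive1_powR (x - 1) t0).
- split.
  + move=> t; rewrite in_itv/= => /andP[et _].
    by case: (dF t (lt_trans e0 et)).
  + by apply: cvg_at_right_filter; exact: cF.
  + by apply: cvg_at_left_filter; exact: cF.
- move=> t; rewrite in_itv/= => /andP[et _].
  have := dF t (lt_trans e0 et) => h; rewrite derive1E; exact: derive_val.
Qed.

Lemma integral_powR_lty (x : R) : 0 < x ->
  (\int[mu]_(t in `]0%R, 1%R]) (t `^ (x - 1))%:E < +oo)%E.
Proof.
move=> x0; apply: (@le_lt_trans _ _ (x^-1)%:E); last exact: ltry.
pose E (k : nat) : set (measurableTypeR R) := `[k.+2%:R^-1, 1%R]%classic.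
have -> : `]0%R, 1%R]%classic = \bigcup_k E k.
  apply/seteqP; split=> t /=.
    rewrite in_itv/= => /andP[t0 t1].
    have [k] := ltr_add_invr t0; rewrite add0r => kt.
    exists k => //; rewrite /E/= in_itv/= t1 andbT (le_trans _ (ltW kt))//.
    by rewrite lef_pV2 ?posrE// ler_nat.
  move=> [k _]; rewrite /E/= !in_itv/= => /andP[kt ->]; rewrite andbT.
  by rewrite (lt_le_trans _ kt)// invr_gt0.
have mpow (A : set (measurableTypeR R)) : measurable A -> measurable_fun A (fun t => (t `^ (x - 1))%:E).
  by move=> mA; apply/measurable_EFinP; apply: measurable_funTS; exact: measurable_powR.
have cvE := @ge0_nondecreasing_set_cvg_integral _ _ R E (fun t => (t `^ (x - 1))%:E) mu.
have {}cvE : (\int[mu]_(t in E k) (t `^ (x - 1))%:E @[k --> \oo] -->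
  \int[mu]_(t in \bigcup_k E k) (t `^ (x - 1))%:E)%E.
  apply: cvE => //.
  - apply/nondecreasing_seqP => k; apply/subsetPset => t; rewrite /E/= !in_itv/= => /andP[kt ->].
    rewrite andbT (le_trans _ kt)// lef_pV2 ?posrE// ler_nat//.
  - by move=> k; exact: measurable_itv.
  - by move=> k; apply: mpow; exact: measurable_itv.
  - by move=> k t _; rewrite lee_fin powR_ge0.
rewrite -(cvg_lim _ cvE)//; apply: lime_le; first by apply/cvg_ex; eexists; exact: cvE.
apply: nearW => k; apply: integral_powR_le => //.
by rewrite invf_lt1// ltr1n.
Qed.

(** On ]0, 1] the integrand is at most t^(x - 1).  On ]1, +oo[ the inequality
    ln t <= t / m - 1 + ln m with m = 2 (|x - 1| + 1) bounds t^(x - 1) by a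
    constant times exp (t / 2), so that the integrand is dominated by an
    exponential density. *)
Lemma eGamma_lty (x : R) : 0 < x -> (eGamma x < +oo)%E.
Proof.
move=> x0; pose m : R := 2 * (`|x - 1| + 1).
have m0 : 0 < m by rewrite /m mulr_gt0// ltr_wpDl.
pose C : R := expR (`|x - 1| * ln m).
pose f (t : R) : \bar R := ((EFin \o (fun t : R => t `^ (x - 1))) \_ `]0%R, 1%R]) t.
pose g (t : R) : \bar R := ((C * 2)%:E * (exponential_pdf 2^-1 t)%:E)%E.
have mpow : measurable_fun setT (EFin \o (fun t : R => t `^ (x - 1))).
  by apply/measurable_EFinP; exact: measurable_powR.
have f0 t : (0 <= f t)%E.
  by rewrite /f patchE; case: ifP => // _; rewrite lee_fin powR_ge0.
have C2 : 0 <= C * 2 by rewrite mulr_ge0// expR_ge0.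
have g0 t : (0 <= g t)%E.
  by rewrite /g -EFinM lee_fin mulr_ge0// exponential_pdf_ge0.
have mf : measurable_fun setT f.
  have [h _] := @measurable_restrictT _ _ (measurableTypeR R) _ `]0%R, 1%R]%classic
    (EFin \o (fun t : R => t `^ (x - 1))) (measurable_itv _).
  by apply: h; exact: measurable_funTS.
have mg : measurable_fun setT g.
  apply: emeasurable_funM => //; apply/measurable_EFinP; exact: measurable_exponential_pdf.
apply: (@le_lt_trans _ _ (\int[mu]_t (f t + g t))%E).
  apply: ge0_le_integral => //.
  - by move=> t _; rewrite lee_fin mulr_ge0 ?ppowR_ge0 ?expR_ge0.
  - apply/measurable_EFinP; apply: measurable_funM; first exact: measurable_ppowR_comp.
    by apply: measurableT_comp => //; apply: measurableT_comp.
  - exact: emeasurable_funD.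
  move=> t _; have [t0|t0] := ltP 0 t; last first.
    by rewrite le0_ppowR// mul0r adde_ge0.
  rewrite gt0_ppowR//; have [t1|t1] := leP t 1.
    rewrite /f patchE ifT; last by rewrite inE/= in_itv/= t0 t1.
    rewrite -[leLHS]adde0 leeD// lee_fin ler_piMr ?powR_ge0//.
    by rewrite -[leRHS]expR0 ler_expR oppr_le0 ltW.
  rewrite -[leLHS]add0e leeD// /g -EFinM lee_fin /exponential_pdf patchE ifT; last first.
    by rewrite inE/= in_itv/= andbT ltW.
  rewrite (_ : C * 2 * _ = C * expR (- 2^-1 * t)); last by field.
  rewrite /C /powR gt_eqF// -!expRD ler_expR.
  have lt0 : 0 <= ln t by rewrite ln_ge0// ltW.
  have h1 : (x - 1) * ln t <= `|x - 1| * ln t by rewrite ler_wpM2r// ler_norm.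
  have h2 : ln t <= t / m - 1 + ln m.
    have -> : ln t = ln (t / m) + ln m by rewrite -lnM ?posrE ?divr_gt0// divfK// gt_eqF.
    rewrite lerD2r; have := @le_ln1Dx R (t / m - 1).
    by rewrite addrCA subrr addr0; apply; rewrite ltrBrDr addNr divr_gt0.
  have h3 : `|x - 1| * ln t <= `|x - 1| * (t / m - 1 + ln m) by rewrite ler_wpM2l.
  have h4 : `|x - 1| * (t / m) <= t / 2.
    rewrite mulrCA; apply: ler_wpM2l; first exact: ltW.
    by rewrite ler_pdivrMr// /m; have := normr_ge0 (x - 1); lra.
  rewrite !mulrDr in h3; have := normr_ge0 (x - 1); lra.
rewrite ge0_integralD// lte_add_pinfty//.
  by rewrite /f -integral_mkcond; exact: integral_powR_lty.
rewrite /g ge0_integralZl//.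
- by rewrite integral_exponential_pdf// mule1 ltry.
- by apply/measurable_EFinP; exact: measurable_exponential_pdf.
- by move=> t _; rewrite lee_fin exponential_pdf_ge0.
Qed.

Lemma eGamma_ltyE (x : R) : (eGamma x < +oo)%E = (0 < x).
Proof.
have [x0|x0] := ltP 0 x; first exact: eGamma_lty.
by rewrite eGamma_infty.
Qed.

Lemma eGammaE (x : R) : 0 < x -> eGamma x = (Gamma x)%:E.
Proof.
move=> x0; rewrite -[LHS]fineK ?ge0_fin_numE ?eGamma_ge0 ?eGamma_lty//.
rewrite /Gamma /Rintegral /eGamma integral_mkcond; congr (fine _)%:E.
apply: eq_integral => t _; rewrite patchE /ppowR.
have [t0|t0] := ltP 0 t; first by rewrite ifT// inE/= in_itv/= t0.
by rewrite mul0r ifF//; apply/negbTE; rewrite notin_setE/= in_itv/= andbT; apply/negP; rewrite -leNgt.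
Qed.
End eGamma_finite.

(** * Iterated integrals along a path *)

Section chain.
Context {R : realType}.
Local Notation mR := (measurableTypeR R).
Local Notation mu := (@lebesgue_measure R).
Implicit Types (al p be q : nat -> R).

Definition shift (f : nat -> R) : nat -> R := fun i => f i.+1.

(** The integrand on a path with n edges.  The variable a of vertex 0 is kept
    apart from the variables t of the other vertices, because the recursion on
    the path conditions on its first vertex; u holds the edge variables.  The
    entries al, p belong to vertices and be, q to edges. *)
Definition chain n al p be q (a : R) (t u : seq R) : R :=
  vertex (al 0%N) (p 0%N) a *
  \prod_(i < n) (edge (be i) (q i) (nth 0 (a :: t) i) (nth 0 u i) (nth 0 t i) *
                 vertex (al i.+1) (p i.+1) (nth 0 t i)).

Lemma chain0 al p be q a t u : chain 0 al p be q a t u = vertex (al 0%N) (p 0%N) a.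
Proof. by rewrite /chain big_ord0 mulr1. Qed.

Lemma chainS n al p be q a c t b u :
  chain n.+1 al p be q a (c :: t) (b :: u) =
  vertex (al 0%N) (p 0%N) a * (edge (be 0%N) (q 0%N) a b c *
  chain n (shift al) (shift p) (shift be) (shift q) c t u).
Proof. by rewrite /chain big_ord_recl/= !mulrA. Qed.

Lemma chain_ge0 n al p be q a t u : 0 <= chain n al p be q a t u.
Proof.
apply: mulr_ge0; first exact: vertex_ge0.
by apply: prodr_ge0 => i _; apply: mulr_ge0; [exact: edge_ge0|exact: vertex_ge0].
Qed.

Lemma measurable_fun_nth d (T : measurableType d) n (f : T -> n.-tuple mR) i :
  measurable_fun setT f -> measurable_fun setT (fun z => nth (0 : R) (f z) i).
Proof.
move=> mf; have [ni|iln] := leqP n i.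
  rewrite (_ : (fun z => _) = cst 0); first exact: measurable_cst.
  by apply/funext => z; rewrite nth_default// size_tuple.
rewrite (_ : (fun z => _) = (fun t : n.-tuple mR => tnth t (Ordinal iln)) \o f).
  exact: measurableT_comp (measurable_tnth _) mf.
by apply/funext => z /=; rewrite (tnth_nth 0).
Qed.

Lemma measurable_chain d (T : measurableType d) n al p be q
    (a : T -> R) (t u : T -> n.-tuple mR) :
  measurable_fun setT a -> measurable_fun setT t -> measurable_fun setT u ->
  measurable_fun setT (fun z => chain n al p be q (a z) (t z) (u z)).
Proof.
move=> ma mt mu'; apply: measurable_funM; first exact: measurable_vertex.
apply: measurable_prod => i _; apply: measurable_funM; last first.
  exact/measurable_vertex/measurable_fun_nth.
apply: measurable_edge; [|exact: measurable_fun_nth..].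
by case: i => -[|i] ni /=; [exact: ma|exact: measurable_fun_nth].
Qed.

(** Tonelli for the first coordinate of a tuple. *)
Lemma ge0_integral_tuple_cons n (f : n.+1.-tuple mR -> \bar R) :
  measurable_fun setT f -> (forall t, 0 <= f t)%E ->
  (\int[lebesgue_tuple R n.+1]_t f t =
   \int[mu]_a \int[lebesgue_tuple R n]_t f (tuple_cons (a, t)))%E.
Proof.
move=> mf f0.
rewrite (@ge0_integral_pushforward _ _ _ _ _ _ (@measurable_tuple_cons R n)
  (mu \x lebesgue_tuple R n)%E setT f measurableT mf)//.
rewrite preimage_setT fubini_tonelli1//; last by move=> z; exact: f0.
by apply: measurableT_comp mf _; exact: measurable_tuple_cons.
Qed.

Lemma integral_tuple0 (f : 0.-tuple mR -> \bar R) :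
  (\int[lebesgue_tuple R 0]_t f t = f [tuple])%E.
Proof.
rewrite (_ : f = cst (f [tuple])); last by apply/funext => t; rewrite tuple0.
rewrite integral_dirac//= diracT mul1e//.
Qed.

Definition chain_integral n al p be q (a : R) : \bar R :=
  (\int[lebesgue_tuple R n]_t \int[lebesgue_tuple R n]_u
     (chain n al p be q a t u)%:E)%E.

Lemma chain_integral_ge0 n al p be q a : (0 <= chain_integral n al p be q a)%E.
Proof.
apply: integral_ge0 => t _; apply: integral_ge0 => u _.
by rewrite lee_fin chain_ge0.
Qed.

Lemma measurable_chain_inner n al p be q (a : R) :
  measurable_fun setT (fun t : n.-tuple mR => \int[lebesgue_tuple R n]_u (chain n al p be q a t u)%:E)%E.
Proof.
pose f (z : n.-tuple mR * n.-tuple mR) := (chain n al p be q a z.1 z.2)%:E.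
have := @measurable_fun_fubini_tonelli_F _ _ _ _ R (lebesgue_tuple R n) f.
apply; last by move=> z; rewrite lee_fin chain_ge0.
by apply/measurable_EFinP; exact: measurable_chain.
Qed.

Lemma measurable_chain_integral n al p be q : measurable_fun setT (chain_integral n al p be q).
Proof.
pose f (z : (mR * n.-tuple mR) * n.-tuple mR) := (chain n al p be q z.1.1 z.1.2 z.2)%:E.
have mf : measurable_fun setT f.
  apply/measurable_EFinP; apply: measurable_chain => //.
  - by apply: measurableT_comp.
  - by apply: measurableT_comp.
have f0 z : (0 <= f z)%E by rewrite lee_fin chain_ge0.
have mg := @measurable_fun_fubini_tonelli_F _ _ _ _ R (lebesgue_tuple R n) f mf f0.
apply: (@measurable_fun_fubini_tonelli_F _ _ _ _ R (lebesgue_tuple R n) _ mg).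
by move=> z; apply: integral_ge0.
Qed.

Lemma chain_integral0 al p be q a : chain_integral 0 al p be q a = (vertex (al 0%N) (p 0%N) a)%:E.
Proof. by rewrite /chain_integral !integral_tuple0 chain0. Qed.

(** The edge variables are independent of each other once the vertex variables
    are fixed: the integral over the first one only involves the first edge. *)
Lemma chain_integralS n al p be q a :
  chain_integral n.+1 al p be q a = ((vertex (al 0%N) (p 0%N) a)%:E *
    \int[mu]_c (edge_integral (be 0%N) (q 0%N) a c *
      chain_integral n (shift al) (shift p) (shift be) (shift q) c))%E.
Proof.
rewrite /chain_integral ge0_integral_tuple_cons; first last.
- by move=> t; apply: integral_ge0 => u _; rewrite lee_fin chain_ge0.
- exact: measurable_chain_inner.
have mW c := @measurable_chain_inner n (shift al) (shift p) (shift be) (shift q) c.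
have W0 c t : (0 <= \int[lebesgue_tuple R n]_u
    (chain n (shift al) (shift p) (shift be) (shift q) c t u)%:E)%E.
  by apply: integral_ge0 => u _; rewrite lee_fin chain_ge0.
rewrite -ge0_integralZl//; first last.
- by rewrite lee_fin vertex_ge0.
- by move=> c _; rewrite mule_ge0 ?edge_integral_ge0//; exact: chain_integral_ge0.
- apply: emeasurable_funM; last exact: measurable_chain_integral.
  rewrite (_ : edge_integral _ _ _ = (fun c => edge_integral (be 0%N) (q 0%N) c a)).
    exact: measurable_edge_integral.
  by apply/funext => c; exact: edge_integralC.
apply: eq_integral => c _.
rewrite -ge0_integralZl//; first last.
- exact: edge_integral_ge0.
rewrite -ge0_integralZl//; first last.
- by rewrite lee_fin vertex_ge0.
- by move=> t _; rewrite mule_ge0 ?edge_integral_ge0.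
- exact: measurable_funeM.
apply: eq_integral => t _.
rewrite ge0_integral_tuple_cons; first last.
- by move=> u; rewrite lee_fin chain_ge0.
- by apply/measurable_EFinP; exact: measurable_chain.
(* The factor coming from the remaining edges does not depend on b. *)
rewrite [(edge_integral _ _ _ _ * _)%E]muleC /edge_integral -ge0_integralZl//; first last.
- by move=> b _; rewrite lee_fin edge_ge0.
- by apply/measurable_EFinP; exact: measurable_edge.
rewrite -ge0_integralZl//; first last.
- by rewrite lee_fin vertex_ge0.
- by move=> b _; rewrite mule_ge0// lee_fin edge_ge0.
- by apply: measurable_funeM; apply/measurable_EFinP; exact: measurable_edge.
apply: eq_integral => b _.
rewrite [in RHS]muleC -muleA -EFinM muleC -ge0_integral_EFinZl.
- by apply: eq_integral => u _; rewrite /= chainS mulrCA mulrA.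
- exact: measurable_chain.
- by move=> u; exact: chain_ge0.
- by apply: mulr_ge0; [exact: edge_ge0|exact: vertex_ge0].
Qed.

Lemma integral_chain n al p be q :
  (\int[lebesgue_incomplete R n.+1]_eta
     (chain n al p be q (thead eta.1) (behead eta.1) eta.2)%:E
   = \int[mu]_a chain_integral n al p be q a)%E.
Proof.
pose tl (z : n.+1.-tuple mR * n.-tuple mR) : n.-tuple mR := [tuple of behead z.1].
pose f (z : n.+1.-tuple mR * n.-tuple mR) :=
  (chain n al p be q (thead z.1) (tl z) z.2)%:E.
have f0 z : (0 <= f z)%E by rewrite lee_fin chain_ge0.
have mf : measurable_fun setT f.
  apply/measurable_EFinP; apply: measurable_chain => //.
  - exact: (measurableT_comp (measurable_tnth _)).
  - exact: (measurableT_comp (@measurable_behead _ _ _)).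
transitivity (\int[lebesgue_tuple R n.+1]_t \int[lebesgue_tuple R n]_u f (t, u))%E.
  exact: (@fubini_tonelli1 _ _ _ _ _ (lebesgue_tuple R n.+1) (lebesgue_tuple R n) f mf f0).
rewrite ge0_integral_tuple_cons.
- apply: eq_integral => a _; apply: eq_integral => t _.
  by apply: eq_integral => u _; rewrite /f /= theadE.
- exact: (@measurable_fun_fubini_tonelli_F _ _ _ _ R (lebesgue_tuple R n) f mf f0).
- by move=> t; apply: integral_ge0 => u _; exact: f0.
Qed.
End chain.

(** * Continuants and Schur complements *)

Section continuant.
Context {R : realType}.
Implicit Types (a b v : nat -> R).

(** The determinant of the symmetric tridiagonal matrix with diagonal a and
    off-diagonal b ([det_tridiag]), given by the expansion along the first
    row. *)
Fixpoint continuant n a b : R :=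
  if n is n'.+1 then
    a 0%N * continuant n' (shift a) (shift b)
    - (if n' is m.+1 then b 0%N ^+ 2 * continuant m (shift (shift a)) (shift (shift b))
       else 0)
  else 1.

Lemma continuant1 a b : continuant 1 a b = a 0%N.
Proof. by rewrite /= mulr1 subr0. Qed.

Lemma continuantSS n a b : continuant n.+2 a b =
  a 0%N * continuant n.+1 (shift a) (shift b)
  - b 0%N ^+ 2 * continuant n (shift (shift a)) (shift (shift b)).
Proof. by []. Qed.

(** The diagonal left after eliminating the first row; the off-diagonal entries
    left are shift b. *)
Definition schur a b : nat -> R :=
  fun i => if i is 0 then a 1%N - b 0%N ^+ 2 / a 0%N else a i.+1.

Lemma continuant_schur n a b : a 0%N != 0 ->
  continuant n.+2 a b = a 0%N * continuant n.+1 (schur a b) (shift b).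
Proof.
move=> a0; rewrite continuantSS.
case: n => [|n].
  by rewrite !continuant1 (erefl : continuant 0 _ _ = 1) /schur /shift; field.
rewrite !continuantSS (erefl : shift (schur a b) = shift (shift a)).
set x := continuant n.+1 _ _; set y := continuant n _ _.
by rewrite (erefl : schur a b 0%N = a 1%N - b 0%N ^+ 2 / a 0%N) /shift; field.
Qed.

(** The quadratic form of a tridiagonal matrix with n off-diagonal entries. *)
Definition quad_form n a b v : R :=
  \sum_(i < n.+1) a i * v i ^+ 2 + 2 * \sum_(i < n) b i * v i * v i.+1.

Lemma quad_form0 a b v : quad_form 0 a b v = a 0%N * v 0%N ^+ 2.
Proof. by rewrite /quad_form big_ord_recl !big_ord0 mulr0 !addr0. Qed.

Lemma quad_formS n a b v : quad_form n.+1 a b v =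
  a 0%N * v 0%N ^+ 2 + 2 * (b 0%N * v 0%N * v 1%N) + quad_form n (shift a) (shift b) (shift v).
Proof.
have e1 : \sum_(i < n.+2) a i * v i ^+ 2 =
    a 0%N * v 0%N ^+ 2 + \sum_(i < n.+1) a i.+1 * v i.+1 ^+ 2.
  by rewrite big_ord_recl.
have e2 : \sum_(i < n.+1) b i * v i * v i.+1 =
    b 0%N * v 0%N * v 1%N + \sum_(i < n) b i.+1 * v i.+1 * v i.+2.
  by rewrite big_ord_recl.
by rewrite /quad_form e1 e2 /shift; ring.
Qed.

Lemma quad_form_schur n a b v : a 0%N != 0 ->
  quad_form n.+1 a b v = a 0%N * (v 0%N + b 0%N / a 0%N * v 1%N) ^+ 2
                    + quad_form n (schur a b) (shift b) (shift v).
Proof.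
move=> a0; rewrite quad_formS; case: n => [|n].
  by rewrite !quad_form0 /shift /=; field.
by rewrite !quad_formS /shift /schur /=; field.
Qed.

Definition posdef n a b := forall v, (exists2 i, (i <= n)%N & v i != 0) -> 0 < quad_form n a b v.

Lemma posdef_gt0 n a b : posdef n a b -> 0 < a 0%N.
Proof.
move=> /(_ (fun i => (i == 0%N)%:R)) -/(_ _)/wrap[|].
  by exists 0%N => //=; exact: oner_neq0.
rewrite /quad_form big_ord_recl/= expr1n mulr1 !big1 ?mulr0 ?addr0//.
- by move=> i _ /=; rewrite mulr0.
- by move=> i _ /=; rewrite expr0n/= mulr0.
Qed.

Lemma posdef_shift n a b : posdef n.+1 a b -> posdef n (shift a) (shift b).
Proof.
move=> pd v [i ilen vi].
have := pd (fun i => if i is j.+1 then v j else 0).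
by rewrite quad_formS/= mulr0 mul0r expr0n/= !mulr0 !add0r; apply; exists i.+1.
Qed.

(** For a given tail of v, the first entry can be chosen so as to kill the square
    in [quad_form_schur]. *)
Lemma posdef_schur n a b : posdef n.+1 a b -> posdef n (schur a b) (shift b).
Proof.
move=> pd v [i ilen vi]; have a0 := posdef_gt0 pd.
have := pd (fun i => if i is j.+1 then v j else - (b 0%N / a 0%N * v 0%N)).
rewrite quad_form_schur ?gt_eqF//= addNr expr0n/= mulr0 add0r.
by apply; exists i.+1.
Qed.

Lemma posdef_continuant n a b : posdef n a b -> 0 < continuant n.+1 a b.
Proof.
elim: n a b => [|n IHn] a b pd; first by rewrite continuant1 (posdef_gt0 pd).
have a0 := posdef_gt0 pd.
by rewrite continuant_schur ?gt_eqF// mulr_gt0// IHn//; exact: posdef_schur.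
Qed.

(** The pivot at the first vertex when the matrix is eliminated from its last
    row upwards, written as a ratio of consecutive trailing minors. *)
Definition schur_tail n a b : R :=
  continuant n.+1 a b / continuant n (shift a) (shift b).

Lemma schur_tail0 a b : schur_tail 0 a b = a 0%N.
Proof. by rewrite /schur_tail continuant1 divr1. Qed.

Lemma schur_tail_gt0 n a b : posdef n a b -> 0 < schur_tail n a b.
Proof.
move=> pd; rewrite divr_gt0 ?posdef_continuant//.
by case: n pd => [|n] pd//; exact: posdef_continuant (posdef_shift pd).
Qed.

Lemma schur_tailS n a b : posdef n.+1 a b ->
  schur_tail n.+1 a b = a 0%N - b 0%N ^+ 2 / schur_tail n (shift a) (shift b).
Proof.
move=> pd; rewrite /schur_tail continuantSS.
have c0 := posdef_continuant (posdef_shift pd).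
rewrite invf_div mulrBl mulfK ?gt_eqF//; congr (_ - _); rewrite -mulrA; congr (_ * (_ / _)).
Qed.
End continuant.

(** * Leaves on the right of the root *)

Section rooted.
Context {R : realType}.
Local Notation mR := (measurableTypeR R).
Local Notation mu := (@lebesgue_measure R).
Implicit Types (al p be q sg a b : nat -> R).

Lemma measurable_edge_integral2 d (T : measurableType d) (be q : R) (f g : T -> R) :
  measurable_fun setT f -> measurable_fun setT g ->
  measurable_fun setT (fun z => edge_integral be q (f z) (g z)).
Proof.
move=> mf mg.
pose h (z : (mR * mR) * mR) := (edge be q z.1.1 z.2 z.1.2)%:E.
have mh := @measurable_fun_fubini_tonelli_F _ _ _ _ R mu h.
have {}mh : measurable_fun setT (fun z : mR * mR => edge_integral be q z.1 z.2).
  apply: mh; last by move=> z; rewrite lee_fin; exact: edge_ge0.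
  by apply/measurable_EFinP; apply: measurable_edge => //; exact: measurableT_comp.
by apply: (measurableT_comp mh (measurable_fun_pair mf mg)).
Qed.

(** With the root at vertex 0, all the other vertices are eliminated from the far
    end of the path, and the resulting function of the root variable has the
    shape of a vertex factor with the pivot of vertex 0 as coefficient.  The
    exponent rho is left free for the induction: it is 0 for a vertex that is a
    child of the previous one, and s_0 - 1 for the root. *)
Lemma chain_integral_root0 n al p be q sg (rho a : R) :
  posdef n al be ->
  p 0%N = rho + (if (0 < n)%N then 1 - sg 1%N else 0) ->
  (forall i, (0 < i <= n)%N -> p i = if (i < n)%N then 1 - sg i.+1 else 0) ->
  (forall i, (i < n)%N -> q i = sg i.+1 - 3 / 2) ->
  (chain_integral n al p be q a =
   \prod_(1 <= i < n.+1) (eGamma (sg i - 1 / 2)) *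
   (Num.sqrt pi ^+ n *
    (\prod_(1 <= i < n.+1) schur_tail (n - i) (fun j => al (i + j)%N) (fun j => be (i + j)%N) `^ (- sg i))
    * vertex (schur_tail n al be) rho a)%:E)%E.
Proof.
elim: n al p be q sg rho a => [|n IHn] al p be q sg rho a pd hp0 hp hq.
  by rewrite chain_integral0 !big_geq// expr0 schur_tail0 hp0 addr0 !mul1r mul1e.
have pd' := posdef_shift pd; have e0 := schur_tail_gt0 pd'.
rewrite chain_integralS.
set K1 : \bar R := (\prod_(2 <= i < n.+2) eGamma (sg i - 1 / 2))%E.
set K2 := \prod_(2 <= i < n.+2) schur_tail (n.+1 - i) (fun j => al (i + j)%N) (fun j => be (i + j)%N) `^ (- sg i).
have K1_ge0 : (0 <= K1)%E by apply: prode_ge0 => i _; exact: eGamma_ge0.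
have K2_ge0 : 0 <= K2 by apply: prodr_ge0 => i _; exact: powR_ge0.
(* The next vertex is not the root: rho = 0 for the shifted path. *)
have W c : chain_integral n (shift al) (shift p) (shift be) (shift q) c =
    (K1 * (Num.sqrt pi ^+ n * K2 * vertex (schur_tail n (shift al) (shift be)) 0 c)%:E)%E.
  rewrite (IHn _ _ _ _ (shift sg) 0)//.
  - rewrite /K1 /K2 !big_add1.
    by congr (_ * _)%E.
  - by rewrite add0r /shift hp// ltnS.
  - by move=> i /andP[i0 ilen]; rewrite /shift hp//.
  - by move=> i ilen; rewrite /shift hq.
have [a0|a0] := leP a 0; first by rewrite !vertex_le0// mul0e mulr0 mule0.
transitivity ((vertex (al 0%N) (p 0%N) a)%:E * ((K1 * (Num.sqrt pi ^+ n * K2)%:E) *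
   \int[mu]_c ((vertex (schur_tail n (shift al) (shift be)) 0 c)%:E *
     edge_integral (be 0%N) (sg 1%N - 3 / 2) c a)))%E.
  congr (_ * _)%E; rewrite -ge0_integralZl//; first last.
  - by apply: mule_ge0 => //; rewrite lee_fin mulr_ge0// exprn_ge0// sqrtr_ge0.
  - by move=> c _; apply: mule_ge0; [rewrite lee_fin; exact: vertex_ge0|exact: edge_integral_ge0].
  - apply: emeasurable_funM; last exact: measurable_edge_integral.
    by apply/measurable_EFinP; exact: measurable_vertex.
  apply: eq_integral => c _; rewrite W edge_integralC hq// EFinM.
  by rewrite muleC -!muleA.
rewrite integral_vertex_edge//.
have -> : (\prod_(1 <= i < n.+2) eGamma (sg i - 1 / 2) = eGamma (sg 1%N - 1 / 2) * K1)%E.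
  by rewrite big_ltn.
have -> : \prod_(1 <= i < n.+2) schur_tail (n.+1 - i) (fun j => al (i + j)%N)
    (fun j => be (i + j)%N) `^ (- sg i) =
  schur_tail n (shift al) (shift be) `^ (- sg 1%N) * K2.
  by rewrite big_ltn// subn1.
have AC (k x y e z : \bar R) : (k * x * (y * e * z) = e * k * (x * y * z))%E.
  by rewrite -!muleA (muleCA e) (muleCA y) (muleCA x).
rewrite [X in (_ * X)%E](_ : _ = (eGamma (sg 1%N - 1 / 2) * K1 * ((Num.sqrt pi ^+ n * K2)%:E *
  (Num.sqrt pi)%:E * (schur_tail n (shift al) (shift be) `^ (- sg 1%N) *
  a `^ (sg 1%N - 1) * expR (be 0%N ^+ 2 / schur_tail n (shift al) (shift be) * a))%:E))%E); last first.
  exact: AC.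
rewrite muleCA; congr (_ * _)%E.
rewrite -!EFinM; congr EFin.
rewrite schur_tailS// hp0/= /vertex !gt0_ppowR//.
(* The power of a and the exponential produced by the leaf are absorbed by
   the exponent and by the coefficient of the vertex factor. *)
rewrite (_ : a `^ rho = a `^ (rho + (1 - sg 1%N)) * a `^ (sg 1%N - 1)); last first.
  by rewrite -gt0_powRD//; congr (_ `^ _); ring.
rewrite (_ : expR (- ((_ - _) * a)) = expR (- (al 0%N * a)) *
   expR (be 0%N ^+ 2 / schur_tail n (shift al) (shift be) * a)); last first.
  by rewrite -expRD; congr expR; ring.
rewrite (exprS (Num.sqrt pi)); ring.
Qed.
End rooted.

(** * Powers of principal minors *)

Section minor_power.
Context {R : realType}.
Implicit Types (a b sg : nat -> R).

Lemma quad_form_recr n a b v : @quad_form R n.+1 a b v =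
  quad_form n a b v + a n.+1 * v n.+1 ^+ 2 + 2 * (b n * v n * v n.+1).
Proof.
have e1 : \sum_(i < n.+2) a i * v i ^+ 2 =
    \sum_(i < n.+1) a i * v i ^+ 2 + a n.+1 * v n.+1 ^+ 2.
  by rewrite big_ord_recr.
have e2 : \sum_(i < n.+1) b i * v i * v i.+1 =
    \sum_(i < n) b i * v i * v i.+1 + b n * v n * v n.+1.
  by rewrite big_ord_recr.
by rewrite /quad_form e1 e2; ring.
Qed.

(** A vector is extended by zero. *)
Lemma posdef_take m n a b : (m <= n)%N -> posdef n a b -> posdef m a b.
Proof.
move=> mn; have := subnK mn; move: (n - m)%N => k <- {n mn}.
elim: k => [//|k IHk]; rewrite addSn => pd; apply: IHk; move: (k + m)%N pd => n pd v [i ilen vi].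
have := pd (fun j => if (j <= n)%N then v j else 0).
rewrite quad_form_recr ltnn expr0n/= !mulr0 !addr0 => h.
suff <- : quad_form n a b (fun j => if (j <= n)%N then v j else 0) = quad_form n a b v.
  by apply: h; exists i; [exact: leqW|rewrite ilen].
rewrite /quad_form; congr (_ + 2 * _); apply: eq_bigr => j _.
  by rewrite -ltnS ltn_ord.
by rewrite ltn_ord leq_eqVlt ltn_ord orbT.
Qed.

(** The function Delta of the theorem at - sg, in terms of continuants: vertices
    are numbered from 0 up to n and r is the root. *)
Definition minor_power n r sg a b : R :=
  \prod_(0 <= i < r) continuant i.+1 a b `^ (sg i.+1 - sg i)
  * continuant n.+1 a b `^ (- sg r)
  * \prod_(r.+1 <= i < n.+1) continuant (n.+1 - i) (fun j => a (i + j)%N) (fun j => b (i + j)%N)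
      `^ (sg i.-1 - sg i).

(** When the root is at vertex 0, only trailing minors occur, and grouping by
    exponents - sg i yields their successive quotients. *)
Lemma minor_power_root0 n sg a b : posdef n a b ->
  minor_power n 0 sg a b =
  \prod_(0 <= i < n.+1) schur_tail (n - i) (fun j => a (i + j)%N) (fun j => b (i + j)%N) `^ (- sg i).
Proof.
elim: n sg a b => [|n IHn] sg a b pd.
  rewrite /minor_power [in RHS]big_ltn// !big_geq// mul1r !mulr1.
  by rewrite continuant1 schur_tail0.
have pd' := posdef_shift pd.
have -> : \prod_(0 <= i < n.+2) schur_tail (n.+1 - i) (fun j => a (i + j)%N)
      (fun j => b (i + j)%N) `^ (- sg i) =
    schur_tail n.+1 a b `^ (- sg 0%N) * minor_power n 0 (shift sg) (shift a) (shift b).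
  by rewrite (IHn _ _ _ pd') big_ltn// big_add1.
rewrite /minor_power !(big_geq (leqnn 0)) !mul1r.
have -> : \prod_(1 <= i < n.+2) continuant (n.+2 - i) (fun j => a (i + j)%N)
      (fun j => b (i + j)%N) `^ (sg i.-1 - sg i) =
    continuant n.+1 (shift a) (shift b) `^ (sg 0%N - sg 1%N) *
    \prod_(1 <= i < n.+1) continuant (n.+1 - i) (fun j => shift a (i + j)%N)
      (fun j => shift b (i + j)%N) `^ (shift sg i.-1 - shift sg i).
  rewrite big_ltn// subn1 big_add1; congr (_ * _).
  by apply: eq_big_nat => -[|i].
have c2 := posdef_continuant pd; have c1 := posdef_continuant pd'.
rewrite (gt0_powRD (sg 0%N) _ c1) /schur_tail.
rewrite powRM ?invr_ge0 ?(ltW c1) ?(ltW c2)//.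
by rewrite -[_^-1]powR_inv1 ?(ltW c1)// -powRrM mulN1r opprK !mulrA.
Qed.

(** Used with c the first pivot, which divides each leading minor once. *)
Lemma prod_powR_telescope (c : R) r (x tau : nat -> R) : 0 < c ->
  (forall i, (i < r)%N -> 0 <= x i) ->
  \prod_(0 <= i < r) (c * x i) `^ (tau i.+1 - tau i) =
  c `^ (tau r - tau 0%N) * \prod_(0 <= i < r) x i `^ (tau i.+1 - tau i).
Proof.
move=> c0; elim: r => [|r IHr] x0; first by rewrite !big_geq// subrr powRr0 mulr1.
rewrite !big_nat_recr//= IHr; last by move=> i ir; apply: x0; exact: ltnW.
rewrite powRM ?x0// ?(ltW c0)//.
rewrite (_ : tau r.+1 - tau 0%N = (tau r - tau 0%N) + (tau r.+1 - tau r)); last by ring.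
by rewrite (gt0_powRD (tau r - tau 0%N) _ c0) mulrACA.
Qed.

(** Removing the first vertex divides the leading minors and the determinant by
    the pivot a_0, and leaves the trailing minors beyond the root unchanged. *)
Lemma minor_powerS n r sg a b : (r <= n)%N -> posdef n.+1 a b ->
  minor_power n.+1 r.+1 sg a b =
  a 0%N `^ (- sg 0%N) * minor_power n r (shift sg) (schur a b) (shift b).
Proof.
move=> rn pd; have a0 := posdef_gt0 pd; have a0' := lt0r_neq0 a0.
have pd' := posdef_schur pd.
rewrite /minor_power.
have -> : \prod_(0 <= i < r.+1) continuant i.+1 a b `^ (sg i.+1 - sg i) =
    a 0%N `^ (sg 1%N - sg 0%N) *
    \prod_(0 <= i < r) (a 0%N * continuant i.+1 (schur a b) (shift b))
       `^ (shift sg i.+1 - shift sg i).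
  rewrite big_ltn// big_add1/= mulr1 subr0; congr (_ * _).
  by apply: eq_bigr => i _; rewrite -continuant_schur.
rewrite prod_powR_telescope//; last first.
  move=> i ir; apply/ltW/posdef_continuant/(posdef_take _ pd').
  by rewrite (leq_trans (ltnW ir)).
rewrite continuant_schur// powRM ?(ltW a0) ?(ltW (posdef_continuant _))//.
have -> : \prod_(r.+2 <= i < n.+2) continuant (n.+2 - i) (fun j => a (i + j)%N)
     (fun j => b (i + j)%N) `^ (sg i.-1 - sg i) =
   \prod_(r.+1 <= i < n.+1) continuant (n.+1 - i) (fun j => schur a b (i + j)%N)
     (fun j => shift b (i + j)%N) `^ (shift sg i.-1 - shift sg i).
  by rewrite big_add1/=; apply: eq_big_nat => -[|i].
have -> : a 0%N `^ (- sg 0%N) = a 0%N `^ (sg 1%N - sg 0%N) *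
    a 0%N `^ (shift sg r - shift sg 0%N) * a 0%N `^ (- sg r.+1).
  by rewrite -!gt0_powRD//; congr (_ `^ _); rewrite /shift; ring.
rewrite /shift; ring.
Qed.
End minor_power.

(** * Leaves on the left of the root *)

Section rooted_integral.
Context {R : realType}.
Local Notation mR := (measurableTypeR R).
Local Notation mu := (@lebesgue_measure R).
Implicit Types (al p be q sg : nat -> R).

(** The factor that an eliminated leaf leaves behind has the shape of a vertex
    factor, so it only modifies the data of the adjacent vertex. *)
Lemma chain_integral_absorb n al p be q al' p' (c k x : R) :
  al' 0%N = al 0%N - k -> p' 0%N = p 0%N + x ->
  shift al' = shift al -> shift p' = shift p ->
  ((expR (k * c) * c `^ x)%:E * chain_integral n al p be q c = chain_integral n al' p' be q c)%E.
Proof.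
move=> al0 p0 als ps.
have E : expR (k * c) * c `^ x * vertex (al 0%N) (p 0%N) c = vertex (al' 0%N) (p' 0%N) c.
  rewrite /vertex al0 p0; have [c0|c0] := ltP 0 c; last by rewrite !le0_ppowR// !mulr0.
  rewrite !gt0_ppowR// (gt0_powRD (p 0%N) _ c0).
  have -> : expR (- ((al 0%N - k) * c)) = expR (k * c) * expR (- (al 0%N * c)).
    by rewrite -expRD; congr expR; ring.
  ring.
case: n => [|n]; first by rewrite !chain_integral0 -EFinM E.
by rewrite !chain_integralS muleA -EFinM E als ps.
Qed.

(** The vertex exponents after removal of vertex 0. *)
Definition absorb_leaf p (x : R) : nat -> R :=
  fun i => if i is 0 then p 1%N + x else p i.+1.

(** Here vertex 0 is a leaf below vertex 1: after exchanging the integrals over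
    their variables, [integral_vertex_edge] applies with the roles of parent and
    child reversed with respect to [chain_integral_root0]. *)
Lemma integral_chain_leaf n al p be q (sg0 : R) :
  0 < al 0%N -> p 0%N = 0 -> q 0%N = sg0 - 3 / 2 ->
  (\int[mu]_a chain_integral n.+1 al p be q a =
   (Num.sqrt pi)%:E * eGamma (sg0 - 1 / 2) * (al 0%N `^ (- sg0))%:E *
   \int[mu]_c chain_integral n (schur al be)
      (absorb_leaf p (sg0 - 1)) (shift be) (shift q) c)%E.
Proof.
move=> al0 p0 q0.
pose W := chain_integral n (shift al) (shift p) (shift be) (shift q).
have mW : measurable_fun setT W by exact: measurable_chain_integral.
have W0 c : (0 <= W c)%E by exact: chain_integral_ge0.
pose f (z : mR * mR) := ((vertex (al 0%N) 0 z.1)%:E *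
  (edge_integral (be 0%N) (sg0 - 3 / 2) z.1 z.2 * W z.2))%E.
have mf : measurable_fun setT f.
  apply: emeasurable_funM.
    by apply/measurable_EFinP; exact: measurable_vertex.
  apply: emeasurable_funM; first exact: measurable_edge_integral2.
  exact: measurableT_comp.
have v0 a : (0 <= (vertex (al 0%N) 0 a)%:E)%E by rewrite lee_fin vertex_ge0.
have f0 z : (0 <= f z)%E by rewrite !mule_ge0 ?edge_integral_ge0.
transitivity (\int[mu]_a \int[mu]_c f (a, c))%E.
  apply: eq_integral => a _; rewrite chain_integralS p0 q0 -ge0_integralZl//.
  - apply: emeasurable_funM; last exact: mW.
    exact: measurable_edge_integral2.
  - by move=> c _; rewrite mule_ge0 ?edge_integral_ge0//; exact: W0.
rewrite (@fubini_tonelli _ _ _ _ R mu mu f mf f0).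
set k := ((Num.sqrt pi)%:E * _ * _)%E.
set W' := chain_integral n (schur al be) _ _ _.
transitivity (\int[mu]_c (k * W' c))%E; last first.
  apply: ge0_integralZl.
  - exact: measurableT.
  - exact: measurable_chain_integral.
  - by move=> c _; exact: chain_integral_ge0.
  - apply: mule_ge0; last by rewrite lee_fin powR_ge0.
    by apply: mule_ge0; [rewrite lee_fin sqrtr_ge0|exact: eGamma_ge0].
apply: eq_integral => c _ /=.
rewrite /W'; have <- := @chain_integral_absorb n (shift al) (shift p) (shift be) (shift q)
  (schur al be) (absorb_leaf p (sg0 - 1)) c
  (be 0%N ^+ 2 / al 0%N) (sg0 - 1) erefl erefl erefl erefl.
rewrite /k {k}.
rewrite -/(W c).
transitivity (W c * \int[mu]_a ((vertex (al 0%N) 0 a)%:E *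
    edge_integral (be 0%N) (sg0 - 3 / 2) a c))%E.
  rewrite -ge0_integralZl//.
  - by apply: eq_integral => a _; rewrite /f/= muleA muleC.
  - apply: emeasurable_funM; first by apply/measurable_EFinP; exact: measurable_vertex.
    exact: measurable_edge_integral.
  - by move=> a _; rewrite mule_ge0 ?edge_integral_ge0.
have [c0|c0] := ltP 0 c; last first.
  have -> : W c = 0%E.
    rewrite /W; case: (n) => [|m]; first by rewrite chain_integral0 vertex_le0.
    by rewrite chain_integralS vertex_le0// mul0e.
  by rewrite mul0e !mule0.
rewrite integral_vertex_edge// muleC muleA; congr (_ * _)%E.
rewrite -!muleA; congr (_ * (_ * _))%E; rewrite -EFinM; congr EFin.
by rewrite -mulrA [c `^ _ * _]mulrC.
Qed.

(** Each vertex collects 1 - sg c for its children c, which are its left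
    neighbour when it lies at or before the root, and its right neighbour when it
    lies at or after the root. *)
Definition vertex_expo n r sg (i : nat) : R :=
  (if i == r then sg r - 1 else 0) + (if (0 < i <= r)%N then 1 - sg i.-1 else 0)
  + (if (r <= i < n)%N then 1 - sg i.+1 else 0).

(** The edge between i and i.+1 belongs to its end farther from the root. *)
Definition edge_expo r sg (i : nat) : R := (if (i < r)%N then sg i else sg i.+1) - 3 / 2.

(** Induction on the root: leaves to its left are removed one by one until it is
    at vertex 0. *)
Lemma integral_chain_integral n r al p be q sg : (r <= n)%N -> posdef n al be ->
  (forall i, (i <= n)%N -> p i = vertex_expo n r sg i) ->
  (forall i, (i < n)%N -> q i = edge_expo r sg i) ->
  (\int[mu]_a chain_integral n al p be q a =
   (Num.sqrt pi ^+ n * minor_power n r sg al be)%:E *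
   (\prod_(0 <= i < n.+1 | i != r) eGamma (sg i - 1 / 2) * eGamma (sg r)))%E.
Proof.
elim: r n al p be q sg => [|r IHr] n al p be q sg rn pd hp hq.
  pose K := \prod_(1 <= i < n.+1) schur_tail (n - i) (fun j => al (i + j)%N)
     (fun j => be (i + j)%N) `^ (- sg i).
  have Ee a : chain_integral n al p be q a = (\prod_(1 <= i < n.+1) (eGamma (sg i - 1 / 2)) *
      (Num.sqrt pi ^+ n * K)%:E * (vertex (schur_tail n al be) (sg 0%N - 1) a)%:E)%E.
    rewrite -muleA -EFinM; apply: chain_integral_root0 => //.
    - by rewrite hp// /vertex_expo eqxx/= addr0.
    - by move=> [|i]//= ilen; rewrite hp// /vertex_expo/= !add0r.
  transitivity (\prod_(1 <= i < n.+1) (eGamma (sg i - 1 / 2)) * (Num.sqrt pi ^+ n * K)%:E *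
      \int[mu]_a (vertex (schur_tail n al be) (sg 0%N - 1) a)%:E)%E.
    under eq_integral do rewrite Ee.
    apply: ge0_integralZl.
    - exact: measurableT.
    - by apply/measurable_EFinP; exact: measurable_vertex.
    - by move=> a _; rewrite lee_fin; exact: vertex_ge0.
    - apply: mule_ge0; first by apply: prode_ge0 => i _; exact: eGamma_ge0.
      rewrite lee_fin mulr_ge0 ?exprn_ge0 ?sqrtr_ge0//.
      by apply: prodr_ge0 => i _; exact: powR_ge0.
  rewrite integral_vertex ?schur_tail_gt0// minor_power_root0//.
  have -> : (\prod_(0 <= i < n.+1 | i != 0%N) eGamma (sg i - 1 / 2) =
             \prod_(1 <= i < n.+1) eGamma (sg i - 1 / 2))%E.
    rewrite [LHS]big_mkcond big_ltn//= mul1e; apply: eq_big_nat => i /andP[i0 _].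
    by rewrite -lt0n i0.
  have -> : \prod_(0 <= i < n.+1) schur_tail (n - i) (fun j => al (i + j)%N)
       (fun j => be (i + j)%N) `^ (- sg i) = schur_tail n al be `^ (- sg 0%N) * K.
    by rewrite big_ltn// subn0.
  by rewrite muleACA muleC -EFinM; congr (_%:E * _)%E; ring.
case: n rn pd hp hq => // n rn pd hp hq; rewrite ltnS in rn.
have al0 := posdef_gt0 pd.
rewrite (@integral_chain_leaf n al p be q (sg 0%N))//; first last.
- by rewrite hq.
- by rewrite hp// /vertex_expo/= !addr0.
rewrite (@IHr n _ _ _ _ (shift sg)) ?minor_powerS//.
- have -> : (\prod_(0 <= i < n.+2 | i != r.+1) eGamma (sg i - 1 / 2) =
     eGamma (sg 0%N - 1 / 2) * \prod_(0 <= i < n.+1 | i != r) eGamma (shift sg i - 1 / 2))%E.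
    rewrite [LHS]big_mkcond big_ltn//= big_add1/=; congr (_ * _)%E.
    by rewrite [RHS]big_mkcond; apply: eq_bigr => i _; rewrite eqSS.
  set P := (\prod_(0 <= i < n.+1 | _) _)%E.
  have AC (x e z y s g : \bar R) : (x * e * y * (z * (s * g)) = x * y * z * (e * s * g))%E.
    by rewrite -!muleA (muleCA z e) (muleCA y e).
  by rewrite AC -!EFinM -/(shift sg r); congr (_%:E * _)%E; rewrite (exprS (Num.sqrt pi)); ring.
- exact: posdef_schur.
- move=> i ilen; case: i ilen => [|i] ilen.
    rewrite /absorb_leaf hp// /vertex_expo eqSS (erefl : (0 < 1 <= r.+1)%N = true).
    by rewrite (erefl : (0 < 0 <= r)%N = false) !ltnS /shift /=; ring.
  by rewrite /absorb_leaf hp.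
- by move=> i iltn; rewrite /shift hq// /edge_expo ltnS.
Qed.
End rooted_integral.

(** * Tridiagonal matrices *)

Section tridiag.
Context {R : realType}.
Implicit Types (a b : nat -> R).

(** The diagonal and off-diagonal entries are sequences indexed by nat, so that
    principal submatrices on intervals and Schur complements amount to shifting
    or modifying sequences. *)
Definition tridiag n a b : 'M[R]_n :=
  \matrix_(i, j) if i == j :> nat then a i
    else if j == i.+1 :> nat then b i else if i == j.+1 :> nat then b j else 0.

Lemma det_tridiag n a b : \det (tridiag n a b) = continuant n a b.
Proof.
elim/ltn_ind: n a b => -[|[|n]] IHn a b.
- by rewrite det_mx00.
- by rewrite det_mx11 mxE eqxx continuant1.
rewrite (expand_det_row _ ord0) continuantSS !big_ord_recl big1 ?addr0; last first.
  by move=> i _; rewrite mxE /= mul0r.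
rewrite !mxE/= /cofactor/= expr0 mul1r expr1.
have -> : row' ord0 (col' ord0 (tridiag n.+2 a b)) = tridiag n.+1 (shift a) (shift b).
  by apply/matrixP => i j; rewrite !mxE.
rewrite IHn//; congr (_ + _).
rewrite (expand_det_col _ ord0) big_ord_recl big1 ?addr0; last first.
  by move=> i _; rewrite !mxE /= mul0r.
rewrite !mxE/= /cofactor/= expr0 mul1r.
have -> : row' ord0 (col' ord0 (row' ord0 (col' (lift ord0 ord0) (tridiag n.+2 a b)))) =
   tridiag n (shift (shift a)) (shift (shift b)).
  by apply/matrixP => i j; rewrite !mxE.
by rewrite IHn// mulN1r mulrN mulrA -expr2.
Qed.

Lemma filter_iota_between n i m : (i + m <= n)%N ->
  [seq x <- iota 0 n | (i < x.+1 <= i + m)%N] = iota i m.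
Proof.
move=> imn; rewrite -(subnKC imn) -addnA iotaD iotaD !filter_cat add0n.
rewrite (eq_in_filter (a2 := pred0)); last first.
  by move=> x; rewrite mem_iota add0n/= ltnS => xi; rewrite leqNgt xi.
rewrite filter_pred0/= (eq_in_filter (a2 := predT)); last first.
  by move=> x; rewrite mem_iota ltnS => /andP[-> ->].
rewrite filter_predT (eq_in_filter (a2 := pred0)) ?filter_pred0 ?cats0//.
by move=> x; rewrite mem_iota => /andP[h _]; rewrite [(x < _)%N]ltnNge h andbF.
Qed.

(** The enumeration of an interval of ordinals is increasing, hence the principal
    submatrix is again tridiagonal, with shifted sequences. *)
Lemma minor_tridiag n a b i m : (i + m <= n)%N ->
  minor (tridiag n a b) i.+1 (i + m) =
  continuant m (fun k => a (i + k)%N) (fun k => b (i + k)%N).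
Proof.
move=> imn; rewrite /minor; set I := (X in principal_submx _ X).
have enumI : map val (enum I) = iota i m.
  rewrite -(filter_iota_between imn) -val_enum_ord filter_map.
  by congr map; rewrite {1}/enum_mem -enumT; apply: eq_filter => x; rewrite /= inE.
have cardI : #|I| = m by rewrite cardE -(size_map val) enumI size_iota.
have valI (k : 'I_#|I|) : val (enum_val k) = (i + k)%N.
  rewrite /enum_val -(nth_map _ 0%N) -?cardE// enumI nth_iota// -cardI//.
have -> : principal_submx (tridiag n a b) I =
    tridiag #|I| (fun k => a (i + k)%N) (fun k => b (i + k)%N).
  by apply/matrixP => k l; rewrite !mxE !valI -!addnS !eqn_add2l.
by rewrite det_tridiag cardI.
Qed.

Lemma minor_tridiag2 n a b i : (i.+1 < n)%N ->
  minor (tridiag n a b) i.+1 i.+2 = a i * a i.+1 - b i ^+ 2.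
Proof.
move=> ilt; have := @minor_tridiag n a b i 2; rewrite addn2 => ->//.
by rewrite continuantSS continuant1 /shift mulr1 addn0 addn1.
Qed.

Lemma sum_path_edge N (F : nat -> nat -> R) :
  \sum_(i < N.+1) \sum_(j < N.+1 | path_edge i j) F i j =
  \sum_(i < N.+1) F i i + \sum_(i < N) (F i i.+1 + F i.+1 i).
Proof.
pose G i j := if (i <= j.+1)%N && (j <= i.+1)%N then F i j else 0.
transitivity (\sum_(i < N.+1) \sum_(j < N.+1) G i j).
  by apply: eq_bigr => i _; rewrite big_mkcond.
elim: N => [|N IHN].
  by rewrite !big_ord_recl !big_ord0 !addr0 /G/=.
rewrite big_ord_recr/=.
under eq_bigr do rewrite big_ord_recr/=.
rewrite big_split/= IHN.
have c1 : \sum_(i < N.+1) G i N.+1 = F N N.+1.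
  rewrite big_ord_recr/= big1 ?add0r; first by rewrite /G !leqnn ltnW.
  by move=> i _; rewrite /G ltnS [(_ <= i)%N]leqNgt ltn_ord andbF.
have c2 : \sum_(j < N.+1) G N.+1 j = F N.+1 N.
  rewrite big_ord_recr/= big1 ?add0r; first by rewrite /G !leqnn ltnW.
  by move=> i _; rewrite /G ltnS [(_ <= i)%N]leqNgt ltn_ord.
rewrite [X in _ + X]big_ord_recr/= c1 c2.
have -> : \sum_(i < N.+2) F i i = \sum_(i < N.+1) F i i + F N.+1 N.+1.
  by rewrite big_ord_recr.
have -> : \sum_(i < N.+1) (F i i.+1 + F i.+1 i) =
    \sum_(i < N) (F i i.+1 + F i.+1 i) + (F N N.+1 + F N.+1 N).
  by rewrite big_ord_recr.
have -> : G N.+1 N.+1 = F N.+1 N.+1 by rewrite /G leqnSn.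
ring.
Qed.

Lemma incomplete_mxE N (eta : incomplete R N.+1) :
  incomplete_mx eta = tridiag N.+1 (nth 0 eta.1) (nth 0 eta.2).
Proof.
apply/matrixP => i j; rewrite !mxE (tnth_nth 0) -val_eqE/=; case: eqP => // ij.
rewrite /path_edge; case: ifP => [/andP[h1 h2]|].
  case: eqP => [->|j1]; first by rewrite (minn_idPl (leqnSn _)).
  case: eqP => [->|i1]; first by rewrite (minn_idPr (leqnSn _)).
  have := leq_trans; lia.
move=> /negbT; rewrite negb_and -!ltnNge => h.
case: eqP => [e|_]; first by lia.
by case: eqP => // e; lia.
Qed.

Section Zspace_coords.
Variables (N : nat) (y : 'M[R]_N.+1).
Definition diag_seq (i : nat) : R := y (inord i) (inord i).
Definition offdiag_seq (i : nat) : R := y (inord i) (inord i.+1).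

Hypothesis yZ : Zspace y.

Lemma Zspace_tridiag : y = tridiag N.+1 diag_seq offdiag_seq.
Proof.
case: yZ => ysym y0; apply/matrixP => i j; rewrite !mxE.
case: eqP => [/val_inj <-|ij]; first by rewrite /diag_seq inord_val.
case: eqP => [e|ji]; first by rewrite /offdiag_seq -e !inord_val.
case: eqP => [e|ij']; first by rewrite /offdiag_seq -e !inord_val -{1}ysym mxE.
by apply: y0; rewrite /path_edge negb_and -!ltnNge; lia.
Qed.

Lemma pairingE (eta : incomplete R N.+1) : pairing y eta =
  \sum_(i < N.+1) diag_seq i * nth 0 eta.1 i + 2 * \sum_(i < N) offdiag_seq i * nth 0 eta.2 i.
Proof.
rewrite /pairing incomplete_mxE Zspace_tridiag.
pose A (a b : nat -> R) i j : R := if i == j then a i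
    else if j == i.+1 then b i else if i == j.+1 then b j else 0.
pose F i j := A diag_seq offdiag_seq i j * A (nth 0 eta.1) (nth 0 eta.2) i j.
transitivity (\sum_(i < N.+1) \sum_(j < N.+1 | path_edge i j) F i j).
  by apply: eq_bigr => i _; apply: eq_bigr => j _; rewrite !mxE.
rewrite sum_path_edge mulr_sumr; congr (_ + _); apply: eq_bigr => i _; rewrite /F /A ?eqxx//.
have -> : (i == i.+1 :> nat) = false by lia.
have -> : (i.+1 == i :> nat) = false by lia.
have -> : (i == i.+2 :> nat) = false by lia.
ring.
Qed.

Lemma quad_form_mx (v : nat -> R) (w : 'cV[R]_N.+1) : (forall i, w i 0 = v i) ->
  (w^T *m y *m w) ord0 ord0 = quad_form N diag_seq offdiag_seq v.
Proof.
move=> wv.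
pose A i j : R := if i == j then diag_seq i
    else if j == i.+1 then offdiag_seq i else if i == j.+1 then offdiag_seq j else 0.
pose F i j := v i * A i j * v j.
transitivity (\sum_(i < N.+1) \sum_(j < N.+1 | path_edge i j) F i j).
  rewrite mxE; under eq_bigr do rewrite mxE mulr_suml.
  rewrite exchange_big/=; apply: eq_bigr => i _; rewrite [RHS]big_mkcond; apply: eq_bigr => j _.
  rewrite mxE !wv; case: ifP => [_|/negbT ne].
    by rewrite [y in LHS]Zspace_tridiag mxE.
  by case: yZ => _ ->//; rewrite mulr0 mul0r.
rewrite sum_path_edge /quad_form mulr_sumr; congr (_ + _); apply: eq_bigr => i _; rewrite /F /A ?eqxx.
  by rewrite mulrAC -expr2 mulrC.
have -> : (i == i.+1 :> nat) = false by lia.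
have -> : (i.+1 == i :> nat) = false by lia.
have -> : (i == i.+2 :> nat) = false by lia.
ring.
Qed.
End Zspace_coords.

Lemma Pcone_posdef N (y : 'M[R]_N.+1) : Pcone R N.+1 y -> posdef N (diag_seq y) (offdiag_seq y).
Proof.
move=> [yZ pd] v [i iN vi].
rewrite -(@quad_form_mx N y yZ v (\col_i v i)); last by move=> j; rewrite mxE.
apply: pd; apply/eqP => /matrixP/(_ (inord i) 0); rewrite !mxE inordK ?ltnS// => e.
by rewrite e eqxx in vi.
Qed.
End tridiag.

(** * The cone Q *)

Section Qcone.
Context {R : realType}.
Implicit Types (a b t u v : nat -> R).

Definition lin_form n a b t u : R :=
  \sum_(i < n.+1) a i * t i + 2 * \sum_(i < n) b i * u i.

Lemma lin_formS n a b t u : lin_form n.+1 a b t u =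
  a 0%N * t 0%N + 2 * (b 0%N * u 0%N) + lin_form n (shift a) (shift b) (shift t) (shift u).
Proof.
have e1 : \sum_(i < n.+2) a i * t i = a 0%N * t 0%N + \sum_(i < n.+1) a i.+1 * t i.+1.
  by rewrite big_ord_recl.
have e2 : \sum_(i < n.+1) b i * u i = b 0%N * u 0%N + \sum_(i < n) b i.+1 * u i.+1.
  by rewrite big_ord_recl.
by rewrite /lin_form e1 e2 /shift; ring.
Qed.

Lemma lin_form_schur n a b t u : lin_form n.+1 a b t u =
  a 0%N * t 0%N + 2 * (b 0%N * u 0%N) + b 0%N ^+ 2 / a 0%N * t 1%N
  + lin_form n (schur a b) (shift b) (shift t) (shift u).
Proof.
rewrite lin_formS; case: n => [|n].
  by rewrite /lin_form !big_ord_recl !big_ord0 /shift /schur/=; ring.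
by rewrite !lin_formS /shift /schur/=; ring.
Qed.

Definition possemidef n a b := forall v, 0 <= quad_form n a b v.

Definition block_pos n t u :=
  (forall i, (i <= n)%N -> 0 < t i) /\
  (forall i, (i < n)%N -> 0 < t i * t i.+1 - u i ^+ 2).

Lemma possemidef_ge0 n a b : possemidef n a b -> 0 <= a 0%N.
Proof.
move=> /(_ (fun i => (i == 0%N)%:R)).
rewrite /quad_form big_ord_recl/= expr1n mulr1 !big1 ?mulr0 ?addr0//.
- by move=> i _ /=; rewrite mulr0.
- by move=> i _ /=; rewrite expr0n/= mulr0.
Qed.

Lemma possemidef_shift n a b : possemidef n.+1 a b -> possemidef n (shift a) (shift b).
Proof.
move=> pd v; have := pd (fun i => if i is j.+1 then v j else 0).
by rewrite quad_formS/= mulr0 mul0r expr0n/= !mulr0 !add0r.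
Qed.

Lemma possemidef_schur n a b : 0 < a 0%N ->
  possemidef n.+1 a b -> possemidef n (schur a b) (shift b).
Proof.
move=> a0 pd v.
have := pd (fun i => if i is j.+1 then v j else - (b 0%N / a 0%N * v 0%N)).
by rewrite quad_form_schur ?gt_eqF//= addNr expr0n/= mulr0 add0r.
Qed.

Lemma possemidef_eq0 n a b : possemidef n.+1 a b -> a 0%N = 0 -> b 0%N = 0.
Proof.
move=> pd a0; apply/eqP/negP => /negP b0.
(* With a_0 = 0 the form is affine in the first entry, which is chosen so as
   to make its value - 1. *)
pose w i : R := if i is j.+1 then (j == 0%N)%:R else - (a 1%N + 1) / (2 * b 0%N).
have := pd w; rewrite quad_formS a0 mul0r add0r.
have -> : quad_form n (shift a) (shift b) (shift w) = a 1%N.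
  rewrite /quad_form big_ord_recl/= expr1n mulr1 !big1 ?mulr0 ?addr0//.
  - by move=> i _; rewrite /shift/= mulr0.
  - by move=> i _; rewrite /shift/= expr0n mulr0.
rewrite /w/= mulr1.
have -> : 2 * (b 0%N * (- (a 1%N + 1) / (2 * b 0%N))) + a 1%N = -1 by field.
by rewrite ler0N1.
Qed.

(** Induction along the path.  If a_0 > 0, then a_0 t_0 + 2 b_0 u_0 +
    b_0^2 / a_0 t_1 is positive as the value of the first block at the vector
    (a_0, b_0), up to the factor a_0, and the rest is the pairing with the Schur
    complement.  If a_0 = 0, semidefiniteness forces b_0 = 0 and the first vertex
    drops out. *)
Lemma possemidef_lin_form n a b t u : possemidef n a b -> block_pos n t u ->
  0 <= lin_form n a b t u /\
  (lin_form n a b t u = 0 -> (forall i, (i <= n)%N -> a i = 0) /\ (forall i, (i < n)%N -> b i = 0)).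
Proof.
elim: n a b t u => [|n IHn] a b t u pd [t0 tu].
  have a0 := possemidef_ge0 pd; have t00 := t0 0%N isT.
  rewrite /lin_form big_ord_recl !big_ord0 mulr0 !addr0; split.
    by rewrite mulr_ge0// ltW.
  by move=> /eqP; rewrite mulf_eq0 (gt_eqF t00) orbF => /eqP a00; split=> // -[].
have bp : block_pos n (shift t) (shift u).
  by split=> i ilen; [exact: t0|exact: tu].
have := possemidef_ge0 pd; rewrite le_eqVlt => /orP[/eqP/esym a0|a0].
  have b0 := possemidef_eq0 pd a0.
  have [l0 lz] := IHn _ _ _ _ (possemidef_shift pd) bp.
  rewrite lin_formS a0 b0 !mul0r mulr0 !add0r; split=> // /lz[az bz].
  by split=> -[|i] ilen//; [exact: az|exact: bz].
have [l0 _] := IHn _ _ _ _ (possemidef_schur a0 pd) bp.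
suff h : 0 < lin_form n.+1 a b t u by split; [exact: ltW|move=> e; rewrite e ltxx in h].
rewrite lin_form_schur; apply: ltr_wpDr => //.
have t1 := t0 1%N isT; have h := tu 0%N isT.
rewrite (_ : _ + _ = ((b 0%N * t 1%N + a 0%N * u 0%N) ^+ 2 +
  a 0%N ^+ 2 * (t 0%N * t 1%N - u 0%N ^+ 2)) / (a 0%N * t 1%N)); last first.
  by field; rewrite !gt_eqF.
rewrite divr_gt0 ?mulr_gt0// ltr_wpDl ?sqr_ge0// mulr_gt0// exprn_gt0//.
Qed.

Lemma eq_quad_form n a b a' b' v : (forall i, (i <= n)%N -> a i = a' i) ->
  (forall i, (i < n)%N -> b i = b' i) -> quad_form n a b v = quad_form n a' b' v.
Proof.
move=> ea eb; rewrite /quad_form; congr (_ + 2 * _); apply: eq_bigr => i _.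
  by rewrite ea// -ltnS.
by rewrite eb.
Qed.

Lemma eq_lin_form n a b a' b' t u : (forall i, (i <= n)%N -> a i = a' i) ->
  (forall i, (i < n)%N -> b i = b' i) -> lin_form n a b t u = lin_form n a' b' t u.
Proof.
move=> ea eb; rewrite /lin_form; congr (_ + 2 * _); apply: eq_bigr => i _.
  by rewrite ea// -ltnS.
by rewrite eb.
Qed.

Lemma diag_seq_tridiag N a b i : (i <= N)%N -> diag_seq (tridiag N.+1 a b) i = a i.
Proof. by move=> iN; rewrite /diag_seq mxE eqxx inordK. Qed.

Lemma offdiag_seq_tridiag N a b i : (i < N)%N -> offdiag_seq (tridiag N.+1 a b) i = b i.
Proof.
move=> iN; rewrite /offdiag_seq mxE !inordK// ?ltnS ?(ltnW iN)//.
have -> : (i == i.+1) = false by lia.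
by rewrite eqxx.
Qed.

Lemma Zspace_of_tridiag N a b : Zspace (tridiag N.+1 a b).
Proof.
split.
  apply/matrixP => i j; rewrite !mxE; case: eqP => [->|ij]; first by rewrite eqxx.
  rewrite (_ : (i == j :> nat) = false); last by lia.
  case: eqP => [e|//]; rewrite (_ : (j == i.+1 :> nat) = false)//; lia.
move=> i j; rewrite /path_edge negb_and -!ltnNge mxE => h.
by case: eqP => [|_]; [lia|]; case: eqP => [|_]; [lia|]; case: eqP => [|_]; [lia|].
Qed.

(** A semidefinite y is the limit of y + e times the identity as e > 0 tends to
    0. *)
Lemma closure_Pcone_tridiag N a b : possemidef N a b ->
  closure (Pcone R N.+1) (tridiag N.+1 a b).
Proof.
move=> psd; set y := tridiag _ _ _; move=> B Bnb.
have cvy : (y + e *: 1%:M) @[e --> (0 : R)^'+] --> y.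
  apply: cvg_at_right_filter.
  rewrite -[X in _ --> X]addr0; apply: cvgD; first exact: cvg_cst.
  rewrite -[X in _ --> X](scale0r (1%:M : 'M[R]_N.+1)).
  by apply: cvgZr_tmp; exact: cvg_id.
have nB : \forall e \near (0 : R)^'+, B (y + e *: 1%:M) by exact: cvy Bnb.
have n0 : \forall e \near (0 : R)^'+, 0 < e by exact: nbhs_right_gt.
have [e [Be e0]] := filter_ex (filterI nB n0).
exists (y + e *: 1%:M); split=> //.
have [yT yz] := Zspace_of_tridiag N a b.
split; first split.
- by rewrite linearD/= linearZ/= trmx1 [y^T]yT.
- move=> i j nij; rewrite mxE [y i j]yz// add0r !mxE; case: eqP => [ij|]; last by rewrite mulr0.
  by move: nij; rewrite ij /path_edge leqnSn.
move=> v v0; rewrite mulmxDr mulmxDl mxE.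
rewrite (@quad_form_mx R N y (conj yT yz) (fun i => v (inord i) 0)); last first.
  by move=> i; rewrite inord_val.
rewrite (eq_quad_form (a' := a) (b' := b)); [|by move=> *; exact: diag_seq_tridiag|by move=> *; exact: offdiag_seq_tridiag].
apply: ltr_wpDl; first exact: psd.
rewrite -scalemxAr mulmx1 -scalemxAl mxE mulr_gt0// mxE.
have [i vi] : exists i, v i 0 != 0.
  apply/existsP; apply: contraNT v0 => /existsPn h; apply/eqP/matrixP => i j.
  by rewrite ord1 mxE; apply/eqP; move: (h i); rewrite negbK.
rewrite (bigD1 i)//= ltr_pwDl//.
  by rewrite mxE -expr2 exprn_even_gt0.
by apply: sumr_ge0 => j _; rewrite mxE -expr2 sqr_ge0.
Qed.

(** The vanishing of entries, the symmetry and each inequality v^T y v >= 0 are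
    closed conditions. *)
Lemma closure_Pcone_Zspace N (y : 'M[R]_N.+1) : closure (Pcone R N.+1) y ->
  Zspace y /\ possemidef N (diag_seq y) (offdiag_seq y).
Proof.
move=> cy.
have cl (f : 'M[R]_N.+1 -> R) (A : set R) : continuous f -> closed A ->
    (forall z, Pcone R N.+1 z -> A (f z)) -> A (f y).
  move=> cf cA h; have cfA : closed (f @^-1` A) by apply: closed_comp => // z _; exact: cf.
  by apply: cfA; apply: closureS cy => z; exact: h.
have yZ : Zspace y.
  split.
    apply/matrixP => i j; rewrite mxE; apply/eqP; rewrite -subr_eq0; apply/eqP.
    apply: (cl (fun z => z j i - z i j) [set 0]).
    - by move=> z; apply: continuousB; exact: coord_continuous.
    - exact: closed_eq.
    - by move=> z [[zT _] _] /=; rewrite -{1}zT mxE subrr.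
  move=> i j nij; apply: (cl (fun z => z i j) [set 0]).
  - by move=> z; exact: coord_continuous.
  - exact: closed_eq.
  - by move=> z [[_ z0] _] /=; exact: z0.
split=> // v; pose w : 'cV[R]_N.+1 := \col_i v i.
have wE i : w i 0 = v i by rewrite mxE.
rewrite -(quad_form_mx yZ wE).
have E z : (w^T *m z *m w) ord0 ord0 = \sum_i \sum_j w j 0 * z j i * w i 0.
  rewrite mxE; apply: eq_bigr => i _; rewrite mxE mulr_suml.
  by apply: eq_bigr => j _; rewrite mxE.
rewrite E; apply: (cl (fun z => \sum_i \sum_j w j 0 * z j i * w i 0) [set x | 0 <= x]).
- apply: continuous_big => [|i _]; first exact: add_continuous.
  apply: continuous_big => [|j _]; first exact: add_continuous.
  move=> z; have h := @coord_continuous _ _ _ j i z.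
  exact: (cvgMr_tmp (b := w i 0) (cvgMl_tmp (a := w j 0) h)).
- exact: closed_ge.
- move=> z [_ zpd] /=; rewrite -E; have [->|w0] := eqVneq w 0.
    by rewrite mulmx0 mxE.
  by rewrite ltW// zpd.
Qed.

Lemma sum_delta n i (w : nat -> R) : (i < n)%N -> \sum_(k < n) (k == i :> nat)%:R * w k = w i.
Proof.
move=> ilt; rewrite (bigD1 (Ordinal ilt))//= eqxx mul1r big1 ?addr0// => k ki.
by rewrite (_ : (k == i :> nat) = false) ?mul0r//; apply: negbTE.
Qed.

(** Testing eta against the squares of coordinate forms gives the diagonal
    entries, and testing it against the square of x v_i + z v_(i+1) gives the
    blocks. *)
Lemma QconeP N (eta : incomplete R N.+1) :
  Qcone R N.+1 eta <-> block_pos N (nth 0 eta.1) (nth 0 eta.2).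
Proof.
set t := nth 0 eta.1; set u := nth 0 eta.2.
have pairE y : Zspace y -> pairing y eta = lin_form N (diag_seq y) (offdiag_seq y) t u.
  by move=> yZ; rewrite pairingE.
split=> [Q|bp y cy y0]; last first.
  have [yZ psd] := closure_Pcone_Zspace cy; rewrite pairE//.
  have [l0 lz] := possemidef_lin_form psd bp.
  rewrite lt_neqAle l0 andbT eq_sym; apply/eqP => /lz[az bz].
  case/eqP: y0; rewrite (Zspace_tridiag yZ); apply/matrixP => i j; rewrite !mxE.
  case: eqP => [_|_]; first by rewrite az// -ltnS.
  case: eqP => [e|_]; first by rewrite bz// -ltnS -e.
  by case: eqP => [e|//]; rewrite bz// -ltnS -e.
have test a b : possemidef N a b -> (exists2 i, (i <= N)%N & a i != 0) -> 0 < lin_form N a b t u.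
  move=> psd [i iN ai].
  rewrite -(@eq_lin_form N (diag_seq (tridiag N.+1 a b)) (offdiag_seq (tridiag N.+1 a b)));
    [|by move=> *; exact: diag_seq_tridiag|by move=> *; exact: offdiag_seq_tridiag].
  rewrite -pairE; last exact: Zspace_of_tridiag.
  apply: Q; first exact: closure_Pcone_tridiag.
  apply/eqP => /matrixP/(_ (inord i) (inord i)); rewrite !mxE eqxx inordK ?ltnS// => e.
  by rewrite e eqxx in ai.
have t0 i : (i <= N)%N -> 0 < t i.
  move=> iN; have := test (fun k => (k == i)%:R) (fun=> 0).
  have lE (w w' : nat -> R) : \sum_(k < N.+1) (k == i :> nat)%:R * w k + 2 * \sum_(k < N) 0 * w' k = w i :> R.
    by rewrite sum_delta// big1 ?mulr0 ?addr0// => k _; rewrite mul0r.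
  rewrite /lin_form lE; apply; last by exists i; rewrite ?eqxx ?oner_neq0.
  move=> v; rewrite /quad_form; under [X in _ + 2 * X]eq_bigr do rewrite -mulrA.
  by rewrite (lE (fun k => v k ^+ 2) (fun k => v k * v k.+1)) sqr_ge0.
split=> // i iN; have ti := t0 i (ltnW iN).
(* This choice minimizes the form of the block for a given z: its value is
   t_i times the determinant. *)
pose x := - u i; pose z := t i.
have lE w w' : lin_form N (fun k => x ^+ 2 * (k == i)%:R + z ^+ 2 * (k == i.+1)%:R)
    (fun k => x * z * (k == i)%:R) w w' = x ^+ 2 * w i + z ^+ 2 * w i.+1 + 2 * (x * z * w' i).
  have e1 : \sum_(k < N.+1) (x ^+ 2 * (k == i :> nat)%:R + z ^+ 2 * (k == i.+1 :> nat)%:R) * w k =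
      x ^+ 2 * w i + z ^+ 2 * w i.+1.
    rewrite -(sum_delta w (ltnW iN : (i < N.+1)%N)) -(sum_delta w (iN : (i.+1 < N.+1)%N)).
    rewrite !mulr_sumr -big_split/=; apply: eq_bigr => k _; ring.
  have e2 : \sum_(k < N) (x * z * (k == i :> nat)%:R) * w' k = x * z * w' i.
    by rewrite -(sum_delta w' iN) mulr_sumr; apply: eq_bigr => k _; ring.
  by rewrite /lin_form e1 e2.
have := test (fun k => x ^+ 2 * (k == i)%:R + z ^+ 2 * (k == i.+1)%:R) (fun k => x * z * (k == i)%:R).
have -> : lin_form N (fun k => x ^+ 2 * (k == i)%:R + z ^+ 2 * (k == i.+1)%:R)
    (fun k => x * z * (k == i)%:R) t u = t i * (t i * t i.+1 - u i ^+ 2).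
  by rewrite lE /x /z; ring.
rewrite pmulr_rgt0//; apply.
- move=> v; have -> : forall a b, quad_form N a b v = lin_form N a b (fun k => v k ^+ 2) (fun k => v k * v k.+1).
    by move=> a b; rewrite /quad_form /lin_form; congr (_ + 2 * _); apply: eq_bigr => k _; rewrite mulrA.
  rewrite lE (_ : _ + _ = (x * v i + z * v i.+1) ^+ 2) ?sqr_ge0//; ring.
- exists i.+1 => //=; rewrite eqxx (_ : (i.+1 == i) = false) ?mulr0 ?add0r ?mulr1; last by lia.
  by rewrite expf_neq0// gt_eqF.
Qed.
End Qcone.

(** * The integrand in coordinates *)

Section bridge.
Context {R : realType}.
Implicit Types (t u al p be q sg e : nat -> R).

Lemma chainE N al p be q (a : R) (tl u : seq R) : chain N al p be q a tl u =
  \prod_(0 <= i < N.+1) vertex (al i) (p i) (nth 0 (a :: tl) i) *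
  \prod_(0 <= i < N) edge (be i) (q i) (nth 0 (a :: tl) i) (nth 0 u i) (nth 0 (a :: tl) i.+1).
Proof.
by rewrite /chain big_split/= mulrA mulrAC !big_mkord [in RHS]big_ord_recl.
Qed.

Lemma big_nat_indic (m k n : nat) (F : nat -> R) : (k <= n)%N ->
  \prod_(m <= i < k) F i = \prod_(0 <= i < n) (if (m <= i < k)%N then F i else 1).
Proof.
move=> kn; rewrite -big_mkcond/= (big_nat_widen _ _ _ _ _ kn).
rewrite big_geq_mkord big_mkord; apply: eq_bigl => i; exact: andbC.
Qed.

(** Products of powers over subranges are all rewritten as products over one
    range, so that the exponents can be compared index by index. *)
Definition prodpow N t e : R := \prod_(0 <= i < N) t i `^ e i.

Lemma prodpowM N t e e' : (forall i, (i < N)%N -> 0 < t i) ->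
  prodpow N t e * prodpow N t e' = prodpow N t (fun i => e i + e' i).
Proof.
move=> t0; rewrite /prodpow -big_split/=; apply: eq_big_nat => i /andP[_ iN].
by rewrite gt0_powRD// t0.
Qed.

Lemma prodpowV N t e : (prodpow N t e)^-1 = prodpow N t (fun i => - e i).
Proof. by rewrite /prodpow -prodfV; apply: eq_bigr => i _; rewrite powRN. Qed.

Lemma prodpow_range m k N t e : (k <= N)%N ->
  \prod_(m <= i < k) t i `^ e i = prodpow N t (fun i => if (m <= i < k)%N then e i else 0).
Proof.
move=> kN; rewrite (big_nat_indic _ _ kN); apply: eq_bigr => i _.
by case: ifP => // _; rewrite powRr0.
Qed.

Lemma prodpow_single k N t (x : R) : (k < N)%N ->
  t k `^ x = prodpow N t (fun i => if i == k then x else 0).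
Proof.
move=> kN; rewrite -(@big_nat1 _ _ *%R k (fun i => t i `^ x)) (@prodpow_range k k.+1 N t (fun=> x))//.
by apply: eq_bigr => i _; rewrite ltnS -eqn_leq eq_sym.
Qed.

Lemma eq_prodpow N t e e' : (forall i, (i < N)%N -> e i = e' i) -> prodpow N t e = prodpow N t e'.
Proof. by move=> h; apply: eq_big_nat => i /andP[_ iN]; rewrite h. Qed.

Section eta.
Variables (N r : nat) (s : 'rV[R]_N.+1) (eta : incomplete R N.+1).
Hypothesis rN : (r <= N)%N.
Let t := nth 0 eta.1.
Let u := nth 0 eta.2.
Let D i := t i * t i.+1 - u i ^+ 2.
Let sg i := entry s i.+1.

(** The convention s_(n+1) = 0. *)
Lemma entry_oversize k : (N.+1 < k)%N -> entry s k = 0.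
Proof. by case: k => //= k Nk; rewrite insubF//=; apply/negbTE; rewrite -leqNgt. Qed.

Lemma minor_incomplete i : (i < N)%N -> minor (incomplete_mx eta) i.+1 i.+2 = D i.
Proof. by move=> iN; rewrite incomplete_mxE minor_tridiag2. Qed.

Hypothesis t0 : forall i, (i <= N)%N -> 0 < t i.
Hypothesis D0 : forall i, (i < N)%N -> 0 < D i.

Lemma deltaE : delta r.+1 s eta =
  prodpow N D (fun i => if (i < r)%N then sg i else sg i.+1) *
  prodpow N.+1 t (fun i => - ((if (1 <= i < r)%N then sg i.-1 else 0)
    + (if i == r then entry s r - sg r + entry s r.+2 else 0)
    + (if (r.+1 <= i < N)%N then sg i.+1 else 0))).
Proof.
rewrite /delta.
have -> : \prod_(1 <= i < r.+1) minor (incomplete_mx eta) i i.+1 `^ entry s i =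
    prodpow N D (fun i => if (0 <= i < r)%N then sg i else 0).
  rewrite -prodpow_range ?leqnn// big_add1; apply: eq_big_nat => i /andP[_ ir].
  by rewrite minor_incomplete// (leq_trans ir).
have -> : \prod_(r.+2 <= i < N.+2) minor (incomplete_mx eta) i.-1 i `^ entry s i =
    prodpow N D (fun i => if (r <= i < N)%N then sg i.+1 else 0).
  rewrite -prodpow_range ?leqnn// big_add1 big_add1; apply: eq_big_nat => i /andP[_ iN].
  by rewrite minor_incomplete.
have -> : \prod_(2 <= i < r.+1) diag_entry eta i `^ entry s i.-1 =
    prodpow N.+1 t (fun i => if (1 <= i < r)%N then sg i.-1 else 0).
  rewrite -prodpow_range ?(leq_trans rN)// big_add1; apply: eq_big_nat => -[|i]//.
have -> : \prod_(r.+2 <= i < N.+1) diag_entry eta i `^ entry s i.+1 =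
    prodpow N.+1 t (fun i => if (r.+1 <= i < N)%N then sg i.+1 else 0).
  by rewrite -prodpow_range ?leqnn// big_add1.
rewrite (_ : diag_entry eta r.+1 = t r)// (@prodpow_single r N.+1)// !prodpowM// prodpowV.
by congr (_ * _); apply: eq_prodpow => i iN /=; rewrite iN andbT; case: ltnP => _; rewrite ?addr0 ?add0r.
Qed.

(** The exponents 1 at inner vertices, 0 at the two ends, and - 1 when the path
    is a single vertex, are the number of neighbours minus one. *)
Lemma phiE : phi eta =
  prodpow N D (fun=> - (3 / 2)) *
  prodpow N.+1 t (fun i => if N == 0%N then -1 else if (1 <= i < N)%N then 1 else 0).
Proof.
rewrite /phi eqSS; case: eqP => [N0|/eqP N0].
  rewrite /prodpow (big_geq (m := 0) (n := N)) ?N0// mul1r big_ltn// big_geq ?N0// mulr1.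
  by rewrite powR_inv1// ltW// t0.
congr (_ * _).
  rewrite big_add1/=; apply: eq_big_nat => i /andP[_ iN].
  by rewrite minor_incomplete.
rewrite -prodpow_range ?leqnn// big_add1/=; apply: eq_big_nat => i /andP[i1 iN].
have ti := t0 (ltnW iN); rewrite powRr1; first by [].
exact: ltW.
Qed.

Lemma delta_phiE : delta r.+1 s eta * phi eta =
  prodpow N D (edge_expo r sg) * prodpow N.+1 t (vertex_expo N r sg).
Proof.
rewrite deltaE phiE mulrACA !prodpowM//; congr (_ * _); apply: eq_prodpow => i.
rewrite ltnS /vertex_expo => iN.
have e2 : entry s r.+2 = if (r < N)%N then sg r.+1 else 0.
  by case: ltnP => // Nr; rewrite entry_oversize.
have e0 : entry s r = if (0 < r)%N then sg r.-1 else 0 by case: (r).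
rewrite e0 e2.
(* The case of a path with a single vertex is part of the case i = r. *)
have [ir|ir|ir] := ltngtP i r.
- have -> : (N == 0%N) = false by lia.
  have -> : (i < N)%N by lia.
  by rewrite !andbT /=; case: ifP => _; ring.
- have -> : (N == 0%N) = false by lia.
  have -> : (0 < i)%N by lia.
  by rewrite /=; case: ifP => _; ring.
- rewrite ir andbF andbT /=; have [N0|N0] := eqVneq N 0%N.
    have -> : (r < N)%N = false by lia.
    have -> : (0 < r)%N = false by lia.
    ring.
  by case: (posnP r) => r0; case: (ltnP r N) => Nr /=; rewrite ?r0; try lia; ring.
Qed.

Lemma chain_eta y : Zspace y ->
  chain N (diag_seq y) (vertex_expo N r sg) (offdiag_seq y) (edge_expo r sg) (thead eta.1) (behead eta.1) eta.2
  = expR (- pairing y eta) * delta r.+1 s eta * phi eta.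
Proof.
move=> yZ; rewrite -mulrA delta_phiE pairingE// chainE.
have -> : thead eta.1 :: behead eta.1 = eta.1 by rewrite [in RHS](tuple_eta eta.1).
rewrite /prodpow.
have -> : \prod_(0 <= i < N.+1) vertex (diag_seq y i) (vertex_expo N r sg i) (t i) =
    expR (- \sum_(i < N.+1) diag_seq y i * t i) * \prod_(0 <= i < N.+1) t i `^ vertex_expo N r sg i.
  rewrite -sumrN expR_sum !big_mkord -big_split/=.
  by apply: eq_bigr => i _; rewrite /vertex gt0_ppowR// t0// -ltnS.
have -> : \prod_(0 <= i < N) edge (offdiag_seq y i) (edge_expo r sg i) (t i) (u i) (t i.+1) =
    expR (- (2 * \sum_(i < N) offdiag_seq y i * u i)) * \prod_(0 <= i < N) D i `^ edge_expo r sg i.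
  rewrite mulr_sumr -sumrN expR_sum !big_mkord -big_split/=.
  by apply: eq_bigr => i _; rewrite /edge gt0_ppowR ?mulrA// D0.
by rewrite opprD expRD; ring.
Qed.
End eta.
End bridge.

(** * Convergence and value of the integral *)

Section final.
Context {R : realType}.

(** Outside Q some vertex or edge factor vanishes, thanks to the truncation of
    powers. *)
Lemma chain_support N al p be q (eta : incomplete R N.+1) :
  ~ block_pos N (nth 0 eta.1) (nth 0 eta.2) ->
  chain N al p be q (thead eta.1) (behead eta.1) eta.2 = 0.
Proof.
have eta1 : thead eta.1 :: behead eta.1 = eta.1 by rewrite [in RHS](tuple_eta eta.1).
move=> nbp; rewrite chainE eta1.
set V := \prod_(0 <= i < N.+1) _; set E := \prod_(0 <= i < N) _.
have [V0|V0] := eqVneq V 0; first by rewrite V0 mul0r.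
have [E0|E0] := eqVneq E 0; first by rewrite E0 mulr0.
case: nbp; split=> i iN.
  rewrite ltNge; apply/negP => ti; move: V0; rewrite /V.
  rewrite big_mkord (bigD1 (Ordinal (iN : (i < N.+1)%N)))//=.
  by rewrite vertex_le0// mul0r eqxx.
rewrite ltNge; apply/negP => Di; move: E0; rewrite /E.
rewrite big_mkord (bigD1 (Ordinal iN))//=.
by rewrite /edge [ppowR _ _]le0_ppowR// mulr0 mul0r eqxx.
Qed.

Lemma chain_gt0 N al p be q (eta : incomplete R N.+1) :
  block_pos N (nth 0 eta.1) (nth 0 eta.2) ->
  0 < chain N al p be q (thead eta.1) (behead eta.1) eta.2.
Proof.
have eta1 : thead eta.1 :: behead eta.1 = eta.1 by rewrite [in RHS](tuple_eta eta.1).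
move=> [t0 D0]; rewrite chainE eta1 !big_mkord; apply: mulr_gt0; apply: prodr_gt0 => i _.
  have ti : 0 < nth 0 eta.1 i by rewrite t0// -ltnS.
  by rewrite /vertex gt0_ppowR// mulr_gt0 ?expR_gt0 ?powR_gt0.
have Di := D0 _ (ltn_ord i).
by rewrite /edge gt0_ppowR// mulr_gt0 ?expR_gt0 ?powR_gt0.
Qed.

Lemma lte_mul_pos (x y : \bar R) : (0 < x)%E -> (0 < y)%E ->
  (x * y < +oo)%E = (x < +oo)%E && (y < +oo)%E.
Proof.
move: x y => [x| |] [y| |]//= x0 y0; rewrite ?ltry//=.
- by rewrite gt0_muley.
- by rewrite gt0_mulye.
Qed.

Lemma prode_gt0 (I : Type) (l : seq I) (P : pred I) (f : I -> \bar R) :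
  (forall i, 0 < f i)%E -> (0 < \prod_(i <- l | P i) f i)%E.
Proof. by move=> f0; elim/big_ind : _ => // x y; exact: mule_gt0. Qed.

Lemma prode_lty (I : Type) (l : seq I) (P : pred I) (f : I -> \bar R) :
  (forall i, 0 < f i)%E ->
  (\prod_(i <- l | P i) f i < +oo)%E = all (fun i => P i ==> (f i < +oo)%E) l.
Proof.
move=> f0; elim: l => [|i l IHl]; first by rewrite big_nil/= ltry.
rewrite big_cons/=; case: (P i) => //=.
by rewrite lte_mul_pos ?prode_gt0// IHl.
Qed.

Lemma entryN n (s : 'rV[R]_n) k : entry (- s) k = - entry s k.
Proof.
by case: k => [|k] /=; [rewrite oppr0|case: insub => [i|] /=; rewrite ?mxE ?oppr0].
Qed.

Lemma Delta_minor_power N r (s : 'rV[R]_N.+1) y : (r <= N)%N -> Zspace y ->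
  Delta r.+1 (- s) y = minor_power N r (fun i => entry s i.+1) (diag_seq y) (offdiag_seq y).
Proof.
move=> rN yZ; rewrite /Delta /minor_power.
set a := diag_seq y; set b := offdiag_seq y; have -> : y = tridiag N.+1 a b by exact: Zspace_tridiag.
have m0 i m : (i + m <= N.+1)%N -> minor (tridiag N.+1 a b) i.+1 (i + m) =
    continuant m (fun k => a (i + k)%N) (fun k => b (i + k)%N).
  exact: minor_tridiag.
rewrite det_tridiag entryN.
congr (_ * _ * _).
  rewrite big_add1; apply: eq_big_nat => i /andP[_ ir].
  by rewrite !entryN opprK addrC (m0 0%N i.+1)// ltnS ltnW// (leq_trans ir).
rewrite big_add1; apply: eq_big_nat => i /andP[ri iN].
have := m0 i (N.+1 - i)%N; rewrite subnKC; last exact: ltnW.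
move=> ->//; rewrite !entryN opprK addrC.
by case: i ri {iN}.
Qed.

Lemma posdef_drop i n (a b : nat -> R) : (i <= n)%N -> posdef n a b ->
  posdef (n - i) (fun j => a (i + j)%N) (fun j => b (i + j)%N).
Proof.
elim: i n a b => [|i IHi] n a b; first by rewrite subn0.
by case: n => // n ilen pd; rewrite subSS; apply: IHi (posdef_shift pd).
Qed.

Lemma minor_power_gt0 n r sg (a b : nat -> R) : (r <= n)%N -> posdef n a b ->
  0 < minor_power n r sg a b.
Proof.
move=> rn pd; rewrite /minor_power !mulr_gt0 ?powR_gt0 ?posdef_continuant//.
  rewrite big_mkord; apply: prodr_gt0 => i _; apply/powR_gt0/posdef_continuant.
  by apply: posdef_take pd; rewrite (leq_trans (ltnW (ltn_ord i))).
rewrite big_nat_cond; apply: prodr_gt0 => i; rewrite andbT => /andP[_ iN]; apply: powR_gt0.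
by rewrite subSn//; apply/posdef_continuant/posdef_drop.
Qed.

Lemma integral_chain_value N r (s : 'rV[R]_N.+1) y (sg := fun i => entry s i.+1) :
  (r <= N)%N -> Pcone R N.+1 y ->
  (\int[lebesgue_incomplete R N.+1]_eta
    (chain N (diag_seq y) (vertex_expo N r sg) (offdiag_seq y) (edge_expo r sg)
       (thead eta.1) (behead eta.1) eta.2)%:E =
  (Num.sqrt pi ^+ N * Delta r.+1 (- s) y)%:E *
  (\prod_(0 <= i < N.+1 | i != r) eGamma (sg i - 1 / 2) * eGamma (sg r)))%E.
Proof.
move=> rN yP; rewrite integral_chain Delta_minor_power//; last by case: yP.
by apply: integral_chain_integral => //; exact: Pcone_posdef.
Qed.

Lemma sqrt_pi_expr N : Num.sqrt pi ^+ N = pi `^ (N%:R / 2) :> R.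
Proof.
rewrite -powR12_sqrt ?pi_ge0// -powR_mulrn ?powR_ge0// -powRrM.
by congr (_ `^ _); rewrite mulrC.
Qed.
End final.

Theorem theorem2 (R : realType) (n M : nat) (s : 'rV[R]_n) (y : 'M[R]_n)
    (hn : (1 <= n)%N) (hM : (1 <= M <= n)%N) (hy : Pcone R n y) :
  let f := fun eta : incomplete R n =>
    expR (- pairing y eta) * delta M s eta * phi eta in
  let condition :=
    (forall i : nat, (1 <= i <= n)%N -> i <> M -> 1 / 2 < entry s i) /\
    0 < entry s M in
  ((lebesgue_incomplete R n).-integrable (Qcone R n) (fun eta => (f eta)%:E)
     <-> condition) /\
  (condition ->
   (\int[lebesgue_incomplete R n]_(eta in Qcone R n) (f eta)%:E)%E =
   (pi `^ ((n%:R - 1) / 2)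
    * (\prod_(1 <= i < n.+1 | i != M) Gamma (entry s i - 1 / 2))
    * Gamma (entry s M) * Delta M (- s) y)%:E).
Proof.
case: n s y hn hM hy => // N s y _; case: M => // r rN hy f condition.
have {}rN : (r <= N)%N by [].
pose sg i := entry s i.+1.
pose F (eta : incomplete R N.+1) := chain N (diag_seq y) (vertex_expo N r sg) (offdiag_seq y)
  (edge_expo r sg) (thead eta.1) (behead eta.1) eta.2.
have F0 eta : 0 <= F eta by exact: chain_ge0.
have mF : measurable_fun setT F.
  apply: (@measurable_chain _ _ _ _ _ _ _ _ (fun eta : incomplete R N.+1 => thead eta.1)
    (fun eta : incomplete R N.+1 => [tuple of behead eta.1]) (fun eta : incomplete R N.+1 => eta.2)).
  - exact: (measurableT_comp (measurable_tnth _)).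
  - exact: (measurableT_comp (@measurable_behead _ _ _)).
  - exact: measurable_snd.
have yZ : Zspace y by case: hy.
have fF eta : Qcone R N.+1 eta -> f eta = F eta.
  by move=> /QconeP[t0 D0]; rewrite /F (chain_eta s rN t0 D0 yZ).
have FQ : Qcone R N.+1 = F @^-1` `]0, +oo[%classic.
  apply/seteqP; split=> eta /=; rewrite in_itv/= andbT.
    by move=> /QconeP; exact: chain_gt0.
  move=> Fgt0; apply/QconeP; apply: contrapT => nbp.
  by move: Fgt0; rewrite /F chain_support// ltxx.
(* Q is the set where the density is positive, hence measurable. *)
have mQ : measurable (Qcone R N.+1).
  by rewrite FQ -[X in measurable X]setTI; apply: mF => //; exact: measurable_itv.
have patchF : (fun eta => (f eta)%:E) \_ (Qcone R N.+1) = EFin \o F.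
  apply/funext => eta; rewrite patchE; case: ifPn => [/set_mem Qe|/negP nQe] /=.
    by rewrite fF.
  by rewrite /F chain_support// => /QconeP Qe; apply: nQe; exact/mem_set.
have intF := integral_chain_value s rN hy; rewrite -/sg in intF.
set G := (\prod_(0 <= i < N.+1 | _) _ * _)%E in intF.
have mp0 : 0 < Num.sqrt pi ^+ N * Delta r.+1 (- s) y.
  by rewrite mulr_gt0 ?exprn_gt0 ?sqrtr_gt0 ?pi_gt0// Delta_minor_power// minor_power_gt0//;
    exact: Pcone_posdef.
have G0 : (0 < G)%E.
  by apply: mule_gt0; [apply: prode_gt0 => i|]; exact: eGamma_gt0.
have condG : (G < +oo)%E <-> condition.
  rewrite /G lte_mul_pos ?eGamma_gt0 ?prode_gt0//; last by move=> i; exact: eGamma_gt0.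
  rewrite eGamma_ltyE prode_lty; last by move=> i; exact: eGamma_gt0.
  split=> [/andP[/allP h sr]|[h sr]].
    split=> // -[//|i] iN ir; rewrite -subr_gt0 -eGamma_ltyE.
    have := h i; rewrite mem_index_iota => /(_ iN)/implyP; apply.
    by apply/eqP => e; apply: ir; rewrite e.
  apply/andP; split=> //; apply/allP => i; rewrite mem_index_iota => iN.
  apply/implyP => ir; rewrite eGamma_ltyE subr_gt0; apply: h => // -[e].
  by rewrite e eqxx in ir.
split.
  rewrite (integrable_mkcond _ mQ) patchF -condG.
  have -> : (G < +oo)%E = (\int[lebesgue_incomplete R N.+1]_eta `|(EFin \o F) eta| < +oo)%E.
    under eq_integral do rewrite /= ger0_norm//.
    by rewrite intF [RHS]lte_mul_pos ?lte_fin ?ltry.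
  split=> [/integrableP[]//|h]; apply/integrableP; split=> //.
  exact/measurable_EFinP.
move=> [h sr]; rewrite integral_mkcond patchF intF /G.
rewrite eGammaE// big_add1/=.
rewrite (_ : \prod_(0 <= i < N.+1 | i != r) eGamma (sg i - 1 / 2) =
  (\prod_(0 <= i < N.+1 | i != r) Gamma (sg i - 1 / 2))%:E)%E; last first.
  rewrite -prodEFin [LHS]big_nat_cond [RHS]big_nat_cond; apply: eq_bigr => i /andP[iN ir].
  by rewrite eGammaE// subr_gt0; apply: h => // -[e]; rewrite e eqxx in ir.
rewrite -!EFinM; congr EFin; rewrite sqrt_pi_expr.
rewrite (_ : N.+1%:R - 1 = N%:R :> R); last by rewrite -natr1 addrK.
rewrite (eq_bigl (fun i => i != r)); last by [].
ring.
Qed.
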